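(* There exists a toroidal vertex algebra structure on $V(T,0)=U(\tau)\otimes_{U(L_r(\mathfrak{b}))}T$ which is uniquely determined by the conditions that $\mathbf{1}=1\otimes 1$ is the vacuum vector and $$Y(\mathfrak{c};x_0,\mathbf{x})=\mathfrak{c}(\mathbf{x}),\qquad Y(a;x_0,\mathbf{x})=a(x_0,\mathbf{x})\quad\text{for }a\in\mathfrak{g},$$ where $\mathfrak{g}\oplus\mathbb{C}\mathfrak{c}\subset T$ is viewed as a subspace of $V(T,0)$ via $u\mapsto 1\otimes u$.
   Context: Fix a positive integer $r$; $\mathbf{x}=(x_1,\dots,x_r)$, $\mathbf{x}^{\mathbf{m}}=\prod x_i^{m_i}$. A toroidal vertex algebra is a vector space $V$ with a linear map $Y(\cdot;x_0,\mathbf{x}):V\to\mathrm{Hom}(V,V[[x_1^{\pm1},\dots,x_r^{\pm1}]]((x_0)))$, $v\mapsto\sum v_{m_0,\mathbf{m}}x_0^{-m_0-1}\mathbf{x}^{-\mathbf{m}}$, and a vector $\mathbf{1}$ with $Y(\mathbf{1};x_0,\mathbf{x})v=v$, $Y(v;x_0,\mathbf{x})\mathbf{1}\in V[[x_0,x_1^{\pm1},\dots,x_r^{\pm1}]]$, and for all $u,v$ the Jacobi identity $z_0^{-1}\delta(\frac{x_0-y_0}{z_0})Y(u;x_0,\mathbf{z}\mathbf{y})Y(v;y_0,\mathbf{y})-z_0^{-1}\delta(\frac{y_0-x_0}{-z_0})Y(v;y_0,\mathbf{y})Y(u;x_0,\mathbf{z}\mathbf{y})=y_0^{-1}\delta(\frac{x_0-z_0}{y_0})Y(Y(u;z_0,\mathbf{z})v;y_0,\mathbf{y})$,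 where $\mathbf{z}\mathbf{y}=(z_iy_i)_i$ and $Y(u;x_0,\mathbf{z}\mathbf{y})=\sum u_{m_0,\mathbf{m}}x_0^{-m_0-1}\mathbf{z}^{-\mathbf{m}}\mathbf{y}^{-\mathbf{m}}$. Let $\mathfrak{g}$ be a finite-dimensional simple Lie algebra over $\mathbb{C}$ with normalized Killing form $\langle\cdot,\cdot\rangle$, and $\hat{\mathfrak{g}}=\mathfrak{g}\otimes\mathbb{C}[t_0^{\pm1}]\oplus\mathbb{C}\mathfrak{c}$ the affine Lie algebra with $\mathfrak{c}$ central and $[a\otimes t_0^m,b\otimes t_0^n]=[a,b]\otimes t_0^{m+n}+m\langle a,b\rangle\delta_{m+n,0}\mathfrak{c}$. Let $L_r=\mathbb{C}[t_1^{\pm1},\dots,t_r^{\pm1}]$, $\mathbf{t}^{\mathbf{m}}=\prod t_i^{m_i}$, and $\tau=\hat{\mathfrak{g}}\otimes L_r$ with $[u\otimes\mathbf{t}^{\mathbf{m}},v\otimes\mathbf{t}^{\mathbf{n}}]=[u,v]\otimes\mathbf{t}^{\mathbf{m}+\mathbf{n}}$. For $a\in\mathfrak{g}$ put $a(x_0,\mathbf{x})=\sum_{(m_0,\mathbf{m})}(a\otimes t_0^{m_0}\mathbf{t}^{\mathbf{m}})x_0^{-m_0-1}\mathbf{x}^{-\mathbf{m}}$ and $\mathfrak{c}(\mathbf{x})=\sum_{\mathbf{m}}(\mathfrak{c}\otimes\mathbf{t}^{\mathbf{m}})\mathbf{x}^{-\mathbf{m}}$, acting on any $\tau$-module. Let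 $\mathfrak{b}=\mathfrak{g}\otimes\mathbb{C}[t_0]$ and $L_r(\mathfrak{b})=\mathfrak{b}\otimes L_r\subset\tau$. Let $T=\mathfrak{g}\oplus\mathbb{C}\mathfrak{c}\oplus\mathbb{C}$ be the $L_r(\mathfrak{b})$-module with $(a\otimes t_0^k\mathbf{t}^{\mathbf{m}})\cdot b=[a,b]$ if $k=0$, $=\langle a,b\rangle\mathfrak{c}$ if $k=1$, $=0$ if $k\ge2$ ($a,b\in\mathfrak{g}$), and $(a\otimes t_0^k\mathbf{t}^{\mathbf{m}})\cdot(\mathbb{C}\mathfrak{c}+\mathbb{C})=0$. Here $1\in\mathbb{C}\subset T$. *)

(* Defs.v *)
From HB Require Import structures.
From mathcomp Require Import all_boot all_order all_algebra.
From mathcomp Require Import complex.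
From mathcomp Require Import Rstruct.
Set Implicit Arguments.
Unset Strict Implicit.
Unset Printing Implicit Defensive.
Import Order.TTheory GRing.Theory Num.Theory.
Local Open Scope ring_scope.

Definition CC : numClosedFieldType := (Rdefinitions.R)[i].

Notation mindex r := 'rV[int]_r.

Definition lin (U W : lmodType CC) (f : U -> W) : Prop :=
  forall (c : CC) (u v : U), f (c *: u + v) = c *: f u + f v.

Section Lie.
Variable g : vectType CC.
Variable br : g -> g -> g.

Definition is_lie_bracket : Prop :=
  (forall a, lin (br a)) /\ (forall b, lin (fun a => br a b)) /\
  (forall a, br a a = 0) /\
  (forall a b c, br a (br b c) + br b (br c a) + br c (br a b) = 0).

Definition is_ideal (U : {vspace g}) : Prop :=
  forall a u, u \in U -> br a u \in U.

Definition is_simple_lie : Prop :=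
  is_lie_bracket /\ (exists a b, br a b != 0) /\
  (forall U : {vspace g}, is_ideal U -> U = 0%VS \/ U = fullv).

Definition killing (a b : g) : CC :=
  \tr (passmx.mxof (vbasis fullv) (vbasis fullv)
        (linfun (br a) \o linfun (br b))%VF).

Definition ad_semisimple (h : g) : Prop :=
  exists s : seq g, <<s>>%VS = fullv /\
    (forall x, x \in s -> exists c : CC, br h x = c *: x).

Definition is_toral (H : {vspace g}) : Prop :=
  (forall h k, h \in H -> k \in H -> br h k \in H) /\
  (forall h, h \in H -> ad_semisimple h).

(** Cartan subalgebra (of a semisimple Lie algebra) = maximal toral subalgebra. *)
Definition is_cartan (H : {vspace g}) : Prop :=
  is_toral H /\ (forall H', is_toral H' -> (H <= H')%VS -> H' = H).

Definition is_root (H : {vspace g}) (alpha : g -> CC) : Prop :=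
  (exists x, x != 0 /\ forall h, h \in H -> br h x = alpha h *: x) /\
  (exists h, h \in H /\ alpha h != 0).

(** t in H is the element dual to alpha w.r.t. the form B:
    B(t,h) = alpha(h) for all h in H; then (alpha,alpha) = alpha(t). *)
Definition dual_elt (B : g -> g -> CC) (H : {vspace g}) (alpha : g -> CC)
  (t : g) : Prop :=
  t \in H /\ forall h, h \in H -> B t h = alpha h.

(** The normalized Killing form: a scalar multiple of the Killing form for
    which long roots alpha satisfy (alpha,alpha) = 2, i.e. the maximum of
    (alpha,alpha) over roots is 2. *)
Definition normalized_killing (B : g -> g -> CC) : Prop :=
  (exists lam : CC, forall a b, B a b = lam * killing a b) /\
  exists H, is_cartan H /\
    (forall alpha t, is_root H alpha -> dual_elt B H alpha t -> alpha t <= 2) /\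
    (exists alpha t, is_root H alpha /\ dual_elt B H alpha t /\ alpha t = 2).
End Lie.

Section Tau.
Variable g : vectType CC.
Variable br : g -> g -> g.
Variable B : g -> g -> CC.
Variable r : nat.

(** A tau-module structure on V is given by the actions of the spanning
    elements  act a k m = a (x) t_0^k t^m  and  cact m = c (x) t^m
    (the action of a (x) t0^k t^m being linear in a). *)
Definition is_tau_module (V : lmodType CC)
  (act : g -> int -> mindex r -> V -> V) (cact : mindex r -> V -> V) : Prop :=
  (forall k m v, lin (fun a => act a k m v)) /\
  (forall a k m, lin (act a k m)) /\
  (forall m, lin (cact m)) /\
  (forall a b k l m n v,
      act a k m (act b l n v) - act b l n (act a k m v)
      = act (br a b) (k + l) (m + n) v
        + ((k%:~R * B a b) * (k + l == 0)%:R) *: cact (m + n) v) /\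
  (forall a k m n v, cact m (act a k n v) = act a k n (cact m v)) /\
  (forall m n v, cact m (cact n v) = cact n (cact m v)).

(** The data of an L_r(b)-module map T -> V, T = g + C c + C 1, given by
    its restriction fg to g and the images fc of c and f1 of 1. *)
Definition is_T_map (V : lmodType CC)
  (act : g -> int -> mindex r -> V -> V)
  (fg : g -> V) (fc f1 : V) : Prop :=
  lin fg /\
  (forall a b (k : nat) m,
      act a k%:Z m (fg b) =
        if k == 0%N then fg (br a b)
        else if k == 1%N then B a b *: fc else 0) /\
  (forall a (k : nat) m, act a k%:Z m fc = 0) /\
  (forall a (k : nat) m, act a k%:Z m f1 = 0).

Definition is_tau_hom (V W : lmodType CC)
  (actV : g -> int -> mindex r -> V -> V) (cactV : mindex r -> V -> V)
  (actW : g -> int -> mindex r -> W -> W) (cactW : mindex r -> W -> W)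
  (phi : V -> W) : Prop :=
  lin phi /\
  (forall a k m v, phi (actV a k m v) = actW a k m (phi v)) /\
  (forall m v, phi (cactV m v) = cactW m (phi v)).

(** (V, iota) is the induced module  U(tau) (x)_{U(L_r(b))} T,
    characterized by its universal property; iota = (ig, ic, i1) is
    u |-> 1 (x) u. *)
Definition is_induced_VT (V : lmodType CC)
  (act : g -> int -> mindex r -> V -> V) (cact : mindex r -> V -> V)
  (ig : g -> V) (ic i1 : V) : Prop :=
  is_tau_module act cact /\ is_T_map act ig ic i1 /\
  forall (W : lmodType CC) (actW : g -> int -> mindex r -> W -> W)
         (cactW : mindex r -> W -> W) (fg : g -> W) (fc f1 : W),
    is_tau_module actW cactW -> is_T_map actW fg fc f1 ->
    (exists phi : V -> W, is_tau_hom act cact actW cactW phi /\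
        (forall a, phi (ig a) = fg a) /\ phi ic = fc /\ phi i1 = f1) /\
    (forall phi psi : V -> W,
        is_tau_hom act cact actW cactW phi ->
        (forall a, phi (ig a) = fg a) -> phi ic = fc -> phi i1 = f1 ->
        is_tau_hom act cact actW cactW psi ->
        (forall a, psi (ig a) = fg a) -> psi ic = fc -> psi i1 = f1 ->
        forall v, phi v = psi v).
End Tau.

Definition binz (m : int) (i : nat) : CC :=
  (\prod_(j < i) (m - (j : nat)%:Z)%:~R) / (i`!)%:R.

Definition signz (l : int) : CC := (-1) ^+ `|l|%N.

(** "sum_{i>=0} F i = sum_{i>=0} G i" for series with finitely many nonzero
    terms: the partial sums eventually agree. *)
Definition eventually_eq_sums (V : lmodType CC) (F G : nat -> V) : Prop :=
  exists N : nat, forall K : nat, (N <= K)%N ->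
    \sum_(i < K) F i = \sum_(i < K) G i.

Section TVA.
Variable r : nat.
Variable V : lmodType CC.

(** Y u k m w  is the coefficient  u_{k,m} w  of  x_0^{-k-1} x^{-m}  in
    Y(u; x_0, x) w. *)
Definition is_toroidal_VA (Y : V -> int -> mindex r -> V -> V) (vac : V) : Prop :=
  (forall k m w, lin (fun u => Y u k m w)) /\
  (forall u k m, lin (Y u k m)) /\
  (* Y(u;x0,x) w lies in V[[x_1^{+-1},...,x_r^{+-1}]]((x0)) *)
  (forall u w, exists N : int, forall k m, N <= k -> Y u k m w = 0) /\
  (forall k m w, Y vac k m w = if (k == -1) && (m == 0) then w else 0) /\
  (* Y(v;x0,x) 1 in V[[x0, x^{+-1}]] *)
  (forall v k m, 0 <= k -> Y v k m vac = 0) /\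
  (* Jacobi identity, coefficient of z0^{-l-1} x0^{-m-1} y0^{-n-1}
     z^{-p} y^{-s} *)
  (forall u v w (l k n : int) (p s : mindex r),
     eventually_eq_sums
       (fun i => binz k i *: Y (Y u (l + i%:Z) p v) (k + n - i%:Z) s w)
       (fun i => ((-1) ^+ i * binz l i) *:
          (Y u (l + k - i%:Z) p (Y v (n + i%:Z) (s - p) w)
           - signz l *: Y v (l + n - i%:Z) (s - p) (Y u (k + i%:Z) p w)))).
End TVA.

(* Main.v *)
(** The fields on [V] commuting with all [cact m] form a [tau]-module: [a (x) t0^k t^p]
    acts on a field [f] by the right-hand side of the Jacobi identity for the pair
    [(a(x0,x), f)]. No locality with [f] is needed, since in the commutator of two such
    actions all terms cancel except those containing a bracket of the two generators. The
    universal property of [V], applied to this module, sends [u] to a field [Y u] and makes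
    the associativity formula [Y (a_k u) = a_k (Y u)] true by construction; in particular
    no PBW theorem is used. By Pascal's rule the Jacobi identity follows from its
    commutator and associativity cases. The commutator of a generator with [Y v] is
    obtained by induction on [v], and then the full Jacobi identity for [u] and [v] by
    induction on [u], using trinomial revision and the Chu-Vandermonde identity. Uniqueness
    is the same induction on [u], since the associativity formula determines [Y (a_k u)]
    from [Y u]. *)

Require Import Defs.
From HB Require Import structures.
From mathcomp Require Import all_boot all_order all_algebra.
From mathcomp Require Import complex boolp functions.
From mathcomp Require Import Rstruct.
From mathcomp Require Import zify ring.
Set Implicit Arguments.
Unset Strict Implicit.
Unset Printing Implicit Defensive.
Import Order.TTheory GRing.Theory Num.Theory.
Local Open Scope ring_scope.

(** The torus variables never mix with x_0: for fixed torus exponents p of [u] and q of [v] the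
    Jacobi identity is a Borcherds identity of two ordinary fields, and p, q are mere labels. Hence
    the calculus is about families [int -> V -> V], and products such as u_i v enter it as separate
    families with hypotheses, since each carries its own label. The induction for the commutator
    looks circular: [a, Y (b_l v)] contains the iterates Y ((a_j b)_i v), hence the Jacobi identity
    of a_j b with v. It closes because a_j b lies in g + C c for j >= 0: the identity for c is
    direct, and the one for [a, b] follows from the commutator of [a, b] with v, which is an
    induction hypothesis as long as the generator stays quantified. Fields are required to commute
    with all [cact m] so that c(x) commutes with every [Y v], as the Jacobi identity for c
    demands. *)

(** * Binomial coefficients with an integer upper argument *)

Section Binomials.
Variable F : numFieldType.

(* [binz] and [signz] are the case [F = CC]. *)
Definition gbin (m : int) (i : nat) : F :=
  (\prod_(j < i) (m - (j : nat)%:Z)%:~R) / (i`!)%:R.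

Definition gsgn (l : int) : F := (-1) ^+ `|l|%N.

Lemma gbin0 m : gbin m 0 = 1.
Proof. by rewrite /gbin big_ord0 fact0 divr1. Qed.

Lemma fact_gbin m i : i`!%:R * gbin m i = \prod_(j < i) (m - (j : nat)%:Z)%:~R.
Proof.
by rewrite /gbin mulrC divfK // pnatr_eq0 -lt0n fact_gt0.
Qed.

Lemma gbin_pascal m i : gbin (m + 1) i.+1 = gbin m i.+1 + gbin m i.
Proof.
have h : i.+1`!%:R != 0 :> F by rewrite pnatr_eq0 -lt0n fact_gt0.
have e : i.+1`!%:R * gbin m i = i.+1%:R * \prod_(j < i) (m - (j : nat)%:Z)%:~R.
  by rewrite factS natrM -mulrA fact_gbin.
apply: (mulfI h); rewrite mulrDr e !fact_gbin big_ord_recl big_ord_recr /=.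
under eq_bigr => j _.
  have -> : m + 1 - (bump 0 j)%:Z = m - (j : nat)%:Z by rewrite /bump; lia.
over.
set P := \prod_(_ < _) _.
rewrite [P * _]mulrC -mulrDl; congr (_ * _).
by rewrite -[i.+1%:R]/(i.+1%:Z%:~R) -intrD; congr (_%:~R); lia.
Qed.

Lemma gbin_small (q j : nat) : (q < j)%N -> gbin q j = 0.
Proof.
by move=> h; rewrite /gbin (bigD1 (Ordinal h)) //= subrr mul0r mul0r.
Qed.

Lemma gbin0n i : gbin 0 i.+1 = 0.
Proof. exact: gbin_small. Qed.

Lemma gbin_nat (q j : nat) : gbin q%:Z j = 'C(q, j)%:R.
Proof.
elim: q j => [|q IH] [|j]; rewrite ?gbin0 ?bin0 ?gbin0n ?bin0n //.
have -> : Posz q.+1 = q%:Z + 1 by lia.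
by rewrite gbin_pascal !IH binS natrD.
Qed.

(** Multiplied by j! t!, both sides become the falling factorial of [m] of length [j + t], on the
    left cut after [j] factors. *)
Lemma gbin_trinomial m j t :
  gbin m j * gbin (m - j%:Z) t = gbin m (j + t) * gbin (j + t)%:Z j.
Proof.
have h (k : nat) : k`!%:R != 0 :> F by rewrite pnatr_eq0 -lt0n fact_gt0.
apply: (mulfI (h j)); apply: (mulfI (h t)).
rewrite mulrCA [t`!%:R * _]mulrCA mulrA !fact_gbin gbin_nat.
rewrite mulrA mulrC mulrCA -!natrM.
have -> : (t`! * j`! * 'C(j + t, j))%N = (j + t)`!.
  by have := bin_fact (leq_addr t j); rewrite addKn; lia.
rewrite [RHS]mulrC fact_gbin big_split_ord /= mulrC; congr (_ * _).
by apply: eq_bigr => i _; congr (_%:~R); rewrite /=; lia.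
Qed.

Lemma gbin_trinomialC m j t :
  gbin m j * gbin (m - j%:Z) t = gbin m t * gbin (m - t%:Z) j.
Proof.
rewrite !gbin_trinomial [(t + j)%N]addnC !gbin_nat; congr (_ * _%:R).
by rewrite -[RHS]bin_sub ?leq_addl // addnK.
Qed.

(** Pascal-type recursions can be run in both directions from 0. *)
Lemma int_ind2 (P : int -> Prop) :
  P 0 -> (forall n, P n -> P (n + 1)) -> (forall n, P (n + 1) -> P n) ->
  forall n, P n.
Proof.
move=> P0 Pu Pd; case=> n; elim: n => [|n IH] //.
- by have := Pu _ IH; congr P; lia.
- by apply: Pd; rewrite NegzE addNr.
by apply: Pd; move: IH; congr P; lia.
Qed.

(** Both sides obey Pascal's rule in [n]. Upward this is the induction step; downward the rule at
    [I.+1] also involves the unknown value at [(n, I)], whence the inner induction on [I]. *)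
Lemma gbin_vandermonde (m n : int) (I : nat) :
  \sum_(i < I.+1) gbin m i * gbin n (I - i) = gbin (m + n) I.
Proof.
elim/int_ind2: n I => [|n IH|n IH] I.
- rewrite big_ord_recr /= subnn gbin0 mulr1 addr0 big1 ?add0r // => i _.
  have -> : (I - i)%N = (I - i).-1.+1 by have := ltn_ord i; lia.
  by rewrite gbin0n mulr0.
- case: I => [|I]; first by rewrite big_ord1 subnn !gbin0 mulr1.
  rewrite addrA gbin_pascal -!IH big_ord_recr /= subnn !gbin0.
  rewrite [\sum_(i < I.+2) _]big_ord_recr /= subnn gbin0 addrAC -big_split /=.
  congr (_ + _); apply: eq_bigr => i _.
  by rewrite subSn ?gbin_pascal ?mulrDr //; have := ltn_ord i; lia.
elim: I => [|I IHI]; first by rewrite big_ord1 subnn !gbin0 mulr1.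
have := IH I.+1; rewrite addrA gbin_pascal -IHI => h.
apply: (addIr (\sum_(i < I.+1) gbin m i * gbin n (I - i))); rewrite -h.
rewrite big_ord_recr /= subnn !gbin0.
rewrite [in RHS]big_ord_recr /= subnn gbin0 addrAC -big_split /=.
congr (_ + _); apply: eq_bigr => i _.
by rewrite subSn ?gbin_pascal ?mulrDr //; have := ltn_ord i; lia.
Qed.

Lemma gsgnD l m : gsgn (l + m) = gsgn l * gsgn m.
Proof.
rewrite /gsgn -exprD -signr_odd -[RHS]signr_odd; congr (_ ^+ _); lia.
Qed.

Lemma gsgn_sqr l : gsgn l * gsgn l = 1.
Proof. by rewrite /gsgn -expr2 sqrr_sign. Qed.

End Binomials.

(** * Linearity as a property of plain functions *)

Section LinearFunctions.
Variables (F : numFieldType) (U W : lmodType F).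

Definition linmap (f : U -> W) :=
  forall (c : F) (u v : U), f (c *: u + v) = c *: f u + f v.

Variable f : U -> W.
Hypothesis lf : linmap f.

Lemma linmap0 : f 0 = 0.
Proof. by have := lf (-1) 0 0; rewrite !scaleN1r !addNr. Qed.

Lemma linmapD u v : f (u + v) = f u + f v.
Proof. by have := lf 1 u v; rewrite !scale1r. Qed.

Lemma linmapZ c u : f (c *: u) = c *: f u.
Proof. by have := lf c u 0; rewrite linmap0 !addr0. Qed.

Lemma linmapN u : f (- u) = - f u.
Proof. by rewrite -scaleN1r linmapZ scaleN1r. Qed.

Lemma linmapB u v : f (u - v) = f u - f v.
Proof. by rewrite linmapD linmapN. Qed.

Lemma linmap_sum I (r : seq I) (P : pred I) (G : I -> U) :
  f (\sum_(i <- r | P i) G i) = \sum_(i <- r | P i) f (G i).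
Proof.
by elim/big_rec2: _ => [|i y1 y2 _ <-]; [exact: linmap0|exact: linmapD].
Qed.
End LinearFunctions.

(** * Sums of finitely supported families *)

Section FiniteSums.
Variables (F : numFieldType).
Implicit Types (V W : lmodType F).

Definition fin1 V (G : nat -> V) := exists N, forall i, (N <= i)%N -> G i = 0.

(** Finite support, expressed by a bound on [i + j] because that form survives diagonal reindexings
    such as [(j + t, i + j)]. *)
Definition fin2 V (G : nat -> nat -> V) :=
  exists N, forall i j, (N <= i + j)%N -> G i j = 0.

(* The sum of a finitely supported family; junk value 0 otherwise. *)
Definition fs V (G : nat -> V) : V :=
  if pselect (fin1 G) is left h then \sum_(i < projT1 (cid h)) G i else 0.

Lemma sum_trunc V (G : nat -> V) N M : (forall i, (N <= i)%N -> G i = 0) ->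
  (N <= M)%N -> \sum_(i < M) G i = \sum_(i < N) G i.
Proof.
move=> h NM; rewrite -(subnKC NM) big_split_ord /= [X in _ + X]big1 ?addr0 //.
by move=> i _; apply: h; rewrite leq_addr.
Qed.

Lemma fsE V N (G : nat -> V) : (forall i, (N <= i)%N -> G i = 0) ->
  fs G = \sum_(i < N) G i.
Proof.
rewrite /fs => h; case: pselect => [h'|[]]; last by exists N.
case: cid => M /= hM.
by case: (leqP N M) => [/(sum_trunc h)|/ltnW/(sum_trunc hM)] ->.
Qed.

Lemma eq_fs V (G H : nat -> V) : G =1 H -> fs G = fs H.
Proof. by move=> /funext ->. Qed.

Lemma fs_eq0 V (G : nat -> V) : (forall i, G i = 0) -> fs G = 0.
Proof. by move=> h; rewrite (@fsE _ 0) ?big_ord0. Qed.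

Lemma fsD V (G H : nat -> V) : fin1 G -> fin1 H ->
  fs (fun i => G i + H i) = fs G + fs H.
Proof.
move=> [N hN] [M hM].
rewrite !(@fsE _ (maxn N M)) ?big_split // => i; rewrite geq_max => /andP[? ?].
- exact: hM.
- exact: hN.
by rewrite hM ?hN ?addr0.
Qed.

Lemma fs_lin V W (f : V -> W) (G : nat -> V) : linmap f -> fin1 G ->
  f (fs G) = fs (fun i => f (G i)).
Proof.
move=> lf [N hN]; rewrite !(@fsE _ N) ?linmap_sum // => i /hN ->.
exact: linmap0.
Qed.

Lemma linmap_scale V (c : F) : linmap (fun v : V => c *: v).
Proof. by move=> d u v; rewrite scalerDr !scalerA mulrC. Qed.

Lemma fin1Z V (c : nat -> F) (G : nat -> V) : fin1 G -> fin1 (fun i => c i *: G i).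
Proof. by move=> [N h]; exists N => i /h ->; rewrite scaler0. Qed.

(** For [c != 0] scaling preserves and reflects finite support, so for a family of infinite support
    both sides take the default value 0 together. *)
Lemma fsZ V c (G : nat -> V) : fs (fun i => c *: G i) = c *: fs G.
Proof.
have [->|c0] := eqVneq c 0.
  by rewrite scale0r fs_eq0 // => i; rewrite scale0r.
case: (pselect (fin1 G)) => [h|h].
  by rewrite (fs_lin (linmap_scale c) h).
rewrite /fs; case: pselect => [[N h']|_]; last by case: pselect => // _; rewrite scaler0.
case: h; exists N => i /h' /eqP; rewrite scaler_eq0 (negPf c0) /=.
by move/eqP.
Qed.

Lemma fsN V (G : nat -> V) : fs (fun i => - G i) = - fs G.
Proof.
rewrite -scaleN1r -fsZ; apply: eq_fs => i; exact/esym/scaleN1r.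
Qed.

Lemma fin1N V (G : nat -> V) : fin1 G -> fin1 (fun i => - G i).
Proof. by move=> [N h]; exists N => i /h ->; rewrite oppr0. Qed.

Lemma fsB V (G H : nat -> V) : fin1 G -> fin1 H ->
  fs (fun i => G i - H i) = fs G - fs H.
Proof. by move=> hG hH; rewrite fsD ?fsN //; exact: fin1N. Qed.

Lemma fin1D V (G H : nat -> V) : fin1 G -> fin1 H -> fin1 (fun i => G i + H i).
Proof.
move=> [N hN] [M hM]; exists (maxn N M) => i; rewrite geq_max => /andP[? ?].
by rewrite hN ?hM ?addr0.
Qed.

Lemma fs_shift V n (G : nat -> V) : (forall i, (i < n)%N -> G i = 0) ->
  fs G = fs (fun i => G (n + i)%N).
Proof.
move=> h; case: (pselect (fin1 G)) => [[N hN]|nf].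
  rewrite (@fsE _ (n + N)) ?(@fsE _ N (fun i => _)); last first.
  - by move=> i hi; apply: hN; lia.
  - by move=> i hi; apply: hN; lia.
  by rewrite big_split_ord /= big1 ?add0r // => i _; apply: h.
rewrite /fs; case: pselect => // _; case: pselect => // -[N hN]; case: nf.
exists (n + N)%N => i hi; have := hN (i - n)%N.
rewrite subnKC; last by lia.
by apply; lia.
Qed.

Lemma fs_recl V (G : nat -> V) : fin1 G -> fs G = G 0 + fs (fun i => G i.+1).
Proof.
move=> [N hN]; rewrite (@fsE _ N.+1) ?(@fsE _ N) ?big_ord_recl // => i hi;
  by apply: hN; lia.
Qed.

Lemma fs_only0 V (G : nat -> V) : (forall i, G i.+1 = 0) -> fs G = G 0.
Proof. by move=> h; rewrite (@fsE _ 1) ?big_ord1 // => -[]. Qed.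

(** The shape in which truncation of fields supplies finiteness: one index is bounded outright, the
    other by a bound depending on the first. Only finitely many rows matter, so these bounds have a
    maximum. *)
Lemma fin2I V (G : nat -> nat -> V) :
  (exists N, forall i j, (N <= i)%N -> G i j = 0) -> (forall i, fin1 (G i)) -> fin2 G.
Proof.
move=> [N hN] /choice[M hM]; exists (N + \max_(i < N) M i)%N => i j hij.
have [/hN->//|iN] := leqP N i.
have : (M i <= \max_(i < N) M i)%N.
  exact: (@leq_bigmax _ (fun i : 'I_N => M i) (Ordinal iN)).
by move: hij; set m := (\max_(_ < _) _) => hij Mi; apply: (hM i); lia.
Qed.

Lemma fin2C V (G : nat -> nat -> V) : fin2 G -> fin2 (fun i j => G j i).
Proof. by move=> [N h]; exists N => i j ij; apply: h; rewrite addnC. Qed.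

Lemma fin2Z V (c : nat -> nat -> F) (G : nat -> nat -> V) :
  fin2 G -> fin2 (fun i j => c i j *: G i j).
Proof. by move=> [N h]; exists N => i j /h ->; rewrite scaler0. Qed.

Lemma fin2_fin1 V (G : nat -> nat -> V) i : fin2 G -> fin1 (G i).
Proof. by move=> [N h]; exists N => j ij; apply: h; lia. Qed.

Lemma fin2_fs V (G : nat -> nat -> V) : fin2 G -> fin1 (fun i => fs (G i)).
Proof.
by move=> [N h]; exists N => i ij; apply: fs_eq0 => j; apply: h; lia.
Qed.

Lemma fsE2 V N (G : nat -> nat -> V) : (forall i j, (N <= i + j)%N -> G i j = 0) ->
  fs (fun i => fs (G i)) = \sum_(i < N) \sum_(j < N) G i j.
Proof.
move=> h; rewrite (@fsE _ N).
  by apply: eq_bigr => i _; apply: fsE => j ?; apply: h; lia.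
by move=> i ?; apply: fs_eq0 => j; apply: h; lia.
Qed.

Lemma fs_swap V (G : nat -> nat -> V) : fin2 G ->
  fs (fun i => fs (G i)) = fs (fun j => fs (fun i => G i j)).
Proof.
move=> [N h]; rewrite (fsE2 h) (@fsE2 _ N (fun j i => G i j)) 1?exchange_big //.
by move=> i j; rewrite addnC; apply: h.
Qed.

Lemma fs_vandermonde V m n (H : nat -> V) : fin1 H ->
  fs (fun i => fs (fun j => (gbin F m i * gbin F n j) *: H (i + j)%N)) =
  fs (fun q => gbin F (m + n) q *: H q).
Proof.
move=> [N hN].
(* With [q = i + j] the range is the triangle [i <= q]; extension by zero makes it a square, where
   the sums can be exchanged. *)
pose G i q := if (i <= q)%N then (gbin F m i * gbin F n (q - i)) *: H q else 0.
rewrite (@eq_fs _ _ (fun i => fs (G i))); last first.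
  move=> i; rewrite (@fs_shift _ i (G i)).
    by apply: eq_fs => j; rewrite /G leq_addr addKn.
  by move=> j; rewrite /G ltnNge; case: leqP.
rewrite fs_swap; last first.
  exists (N + N)%N => i q h; rewrite /G; case: leqP => // iq.
  by rewrite hN ?scaler0 //; lia.
apply: eq_fs => q; rewrite (@fsE _ q.+1); last by move=> i qi; rewrite /G leqNgt qi.
rewrite -gbin_vandermonde scaler_suml; apply: eq_bigr => i _.
by rewrite /G -ltnS ltn_ord.
Qed.
End FiniteSums.

(** * Convolution identities for binomial sums *)

Section BinomialSums.
Variables (F : numFieldType).
Implicit Types (V W : lmodType F).
Local Notation C := (gbin F).
Local Notation sg := (gsgn F).

(** The coefficient of z^i in (1 - z)^m. *)
Definition sbin (m : int) (i : nat) : F := (-1) ^+ i * gbin F m i.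
Local Notation S := sbin.

Lemma sbin_pascal m i : S (m + 1) i.+1 = S m i.+1 - S m i.
Proof. by rewrite /S gbin_pascal exprS; ring. Qed.

Definition fin3 V (G : nat -> nat -> nat -> V) :=
  exists N, forall i j t, (N <= i + j + t)%N -> G i j t = 0.

Lemma fs_rot V (G : nat -> nat -> nat -> V) : fin3 G ->
  fs (fun i => fs (fun j => fs (G i j))) =
  fs (fun t => fs (fun i => fs (fun j => G i j t))).
Proof.
move=> [N h].
rewrite (@eq_fs _ _ _ (fun i => fs (fun t => fs (fun j => G i j t)))).
  rewrite fs_swap //; exists N => i t hit; apply: fs_eq0 => j.
  by apply: h; lia.
by move=> i; apply: fs_swap; exists N => j t hjt; apply: h; lia.
Qed.

Lemma fs_scale3 V (a : nat -> F) (b : nat -> nat -> F) (c : nat -> nat -> nat -> F)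
  (G : nat -> nat -> nat -> V) :
  fs (fun i => a i *: fs (fun j => b i j *: fs (fun t => c i j t *: G i j t))) =
  fs (fun i => fs (fun j => fs (fun t => (a i * b i j * c i j t) *: G i j t))).
Proof.
apply: eq_fs => i; rewrite -fsZ; apply: eq_fs => j; rewrite scalerA -fsZ.
by apply: eq_fs => t; rewrite scalerA.
Qed.

Lemma fs_binV V m n (H : nat -> V) : fin1 H ->
  fs (fun i => C m i *: fs (fun j => C n j *: H (i + j)%N)) =
  fs (fun q => C (m + n) q *: H q).
Proof.
move=> /fs_vandermonde <-; apply: eq_fs => i; rewrite -fsZ.
by apply: eq_fs => j; rewrite scalerA.
Qed.

Lemma fs_sbinV V m n (H : nat -> V) : fin1 H ->
  fs (fun i => S m i *: fs (fun j => S n j *: H (i + j)%N)) =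
  fs (fun q => S (m + n) q *: H q).
Proof.
move=> fH.
have := fs_binV m n (@fin1Z F V (fun i => (-1) ^+ i) H fH).
rewrite (@eq_fs _ _ (fun i => C (m + n) i *: _) (fun q => S (m + n) q *: H q)).
  move=> <-; apply: eq_fs => i; rewrite -!fsZ; apply: eq_fs => j.
  by rewrite !scalerA exprD /S; congr (_ *: _); ring.
by move=> i; rewrite scalerA mulrC.
Qed.

Lemma gsgn_split m (j : nat) : (-1) ^+ j * sg (m - j%:Z) = sg m.
Proof. by rewrite -[(-1) ^+ j]/(sg j%:Z) -gsgnD; congr (sg _); lia. Qed.

(** [fs_tri1] to [fs_tri4] each equate two expansions of one power series, in which x and y mark the
    first and second argument of [H]; here it is (1 + y)^k (1 - x - x y)^m. On coefficients this is
    trinomial revision followed by Vandermonde. *)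
Lemma fs_tri1 V k m (H : nat -> nat -> V) : fin2 H ->
  fs (fun i => C k i *: fs (fun j => S m j *:
    fs (fun t => S (m - j%:Z) t *: H (j + t)%N (i + j)%N))) =
  fs (fun q => S m q *: fs (fun I => C (k + q%:Z) I *: H q I)).
Proof.
move=> [N hN]; rewrite fs_scale3 -fs_rot; last first.
  by exists (N + N)%N => j t i h; rewrite hN ?scaler0 //; lia.
(* Trinomial revision at [q = j + t]: the new coefficient contains [C q j], which vanishes for
   [q < j], so the sum over [q] may start at 0. *)
pose G j q := fs (fun i => (C k i * S m q * C q%:Z j) *: H q (i + j)%N).
rewrite (@eq_fs _ _ _ (fun j => fs (G j))); last first.
  move=> j; rewrite (@fs_shift _ _ j (G j)).
    apply: eq_fs => t; apply: eq_fs => i; congr (_ *: _).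
    rewrite /S exprD.
    by have e := gbin_trinomial F m j t; ring: e.
  by move=> i h; apply: fs_eq0 => q; rewrite gbin_small // mulr0 scale0r.
rewrite fs_swap; last first.
  by exists N => j q h; apply: fs_eq0 => i; rewrite hN ?scaler0 //; lia.
apply: eq_fs => q; rewrite -fsZ fs_swap; last first.
  by exists N => j i h; rewrite hN ?scaler0 //; lia.
under [in RHS]eq_fs => I do rewrite scalerA mulrC -scalerA.
rewrite -(@fs_binV _ k q%:Z (fun I => S m q *: H q I)).
  apply: eq_fs => i; rewrite -fsZ; apply: eq_fs => j; rewrite !scalerA.
  by congr (_ *: _); ring.
by exists N => i h; rewrite hN ?scaler0 //; lia.
Qed.

(** The series is (1 + y)^k (1 - x + y)^m, times the sign [sg m]. *)
Lemma fs_tri2 V k m (H : nat -> nat -> V) : fin2 H ->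
  fs (fun i => C k i *: fs (fun j => (S m j * sg (m - j%:Z)) *:
    fs (fun t => S (m - j%:Z) t *: H t (i + j)%N))) =
  sg m *: fs (fun t => S m t *: fs (fun I => C (k + m - t%:Z) I *: H t I)).
Proof.
move=> [N hN]; rewrite fs_scale3 fs_rot; last first.
  by exists N => i j t h; rewrite hN ?scaler0 //; lia.
rewrite -fsZ; apply: eq_fs => t; rewrite -addrA scalerA.
rewrite -(@fs_binV _ k (m - t%:Z) (fun I => H t I)).
  rewrite -fsZ; apply: eq_fs => i; rewrite scalerA -fsZ; apply: eq_fs => j.
  rewrite scalerA; congr (_ *: _).
  have := gbin_trinomialC F m j t; set x := C m j; set y := C _ t.
  rewrite -(gsgn_split m j) => e.
  by rewrite /S -/x -/y; ring: e.
by exists N => i h; rewrite hN ?scaler0 //; lia.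
Qed.

(** The series is (1 - y)^l (1 + x - y)^m. *)
Lemma fs_tri3 V l m (H : nat -> nat -> V) : fin2 H ->
  fs (fun q => S m q *: fs (fun s => S l s *:
    fs (fun j => C (m - q%:Z) j *: H j (q + s)%N))) =
  fs (fun j => C m j *: fs (fun I => S (l + m - j%:Z) I *: H j I)).
Proof.
move=> [N hN]; rewrite fs_scale3 fs_rot; last first.
  by exists N => i j t h; rewrite hN ?scaler0 //; lia.
apply: eq_fs => j; rewrite -addrA addrC.
rewrite -(@fs_sbinV _ (m - j%:Z) l (fun I => H j I)).
  rewrite -fsZ; apply: eq_fs => q; rewrite scalerA -fsZ; apply: eq_fs => s.
  rewrite scalerA; congr (_ *: _).
  by rewrite /S; have e := gbin_trinomialC F m q j; ring: e.
by exists N => i h; rewrite hN ?scaler0 //; lia.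
Qed.

(** The series is (1 - y)^l (1 - y - x y)^m. *)
Lemma fs_tri4 V l m (H : nat -> nat -> V) : fin2 H ->
  fs (fun s => S l s *: fs (fun q => S m q *:
    fs (fun j => C q%:Z j *: H j (s + q)%N))) =
  fs (fun j => S m j *: fs (fun I => S (l + m - j%:Z) I *: H j (I + j)%N)).
Proof.
move=> [N hN]; rewrite fs_scale3 fs_rot; last first.
  by exists N => i j t h; rewrite hN ?scaler0 //; lia.
apply: eq_fs => j; rewrite -addrA.
rewrite -(@fs_sbinV _ l (m - j%:Z) (fun I => H j (I + j)%N)).
  rewrite -fsZ; apply: eq_fs => s.
  rewrite (@fs_shift _ _ j); last by move=> q h; rewrite gbin_small // mulr0 scale0r.
  rewrite scalerA -fsZ; apply: eq_fs => q.
  rewrite scalerA (_ : s + (j + q) = s + q + j)%N; last by lia.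
  congr (_ *: _).
  have := gbin_trinomial F m j q; rewrite /S exprD => e.
  ring: e.
by exists N => i h; rewrite hN ?scaler0 //; lia.
Qed.
End BinomialSums.

(** * The Borcherds identity for two fields *)

Section Borcherds.
Variables (F : numFieldType) (V : lmodType F).
Implicit Types (a b f u v : int -> V -> V) (l k m n : int) (w : V).
Local Notation C := (gbin F).
Local Notation sg := (gsgn F).
Local Notation S := (sbin F).

Definition field f :=
  (forall k, linmap (f k)) /\ (forall w, exists N : int, forall k, N <= k -> f k w = 0).

(* The coefficients of the two terms of the Jacobi identity in which the fields [a] and
   [f] are multiplied. *)
Definition borcherds a f l k n w : V :=
  fs (fun i => S l i *: a (l + k - i%:Z) (f (n + i%:Z) w)) -
  sg l *: fs (fun i => S l i *: f (n + l - i%:Z) (a (k + i%:Z) w)).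

Lemma field_lin f k : field f -> linmap (f k). Proof. by case. Qed.

Lemma field0 f k : field f -> f k 0 = 0.
Proof. by case=> h _; exact: linmap0. Qed.

Lemma field_trunc f n w : field f -> exists N, forall i : nat, (N <= i)%N -> f (n + i%:Z) w = 0.
Proof.
by case=> _ /(_ w)[N h]; exists `|N - n|%N => i hi; apply: h; lia.
Qed.

Lemma field_fin1 f n w : field f -> fin1 (fun i => f (n + i%:Z) w).
Proof. by move=> hf; have [N h] := field_trunc n w hf; exists N. Qed.

Lemma linmap_fin1 (W : lmodType F) (g : nat -> V -> W) (G : nat -> V) :
  (forall i, linmap (g i)) -> fin1 G -> fin1 (fun i => g i (G i)).
Proof. by move=> lg [N h]; exists N => i /h ->; exact: linmap0. Qed.

Lemma fs_linZ (f : V -> V) (c : nat -> F) (G : nat -> V) : linmap f -> fin1 G ->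
  f (fs (fun i => c i *: G i)) = fs (fun i => c i *: f (G i)).
Proof.
move=> lf fG; rewrite (fs_lin lf (fin1Z c fG)); apply: eq_fs => i.
exact: linmapZ.
Qed.

Lemma fs_scale_swap (a : nat -> F) (b : nat -> F) (G : nat -> nat -> V) : fin2 G ->
  fs (fun i => a i *: fs (fun j => b j *: G i j)) =
  fs (fun j => b j *: fs (fun i => a i *: G i j)).
Proof.
move=> fG; under eq_fs => i do rewrite -fsZ.
rewrite fs_swap; last by do 2 apply: fin2Z.
apply: eq_fs => j; rewrite -fsZ; apply: eq_fs => i.
by rewrite !scalerA mulrC.
Qed.

Lemma fs_split2 (a c : nat -> F) (b b' : nat -> nat -> F) (G G' : nat -> nat -> V) :
  fin2 G -> fin2 G' ->
  fs (fun i => a i *: (fs (fun j => b i j *: G i j) -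
                       c i *: fs (fun j => b' i j *: G' i j))) =
  fs (fun i => a i *: fs (fun j => b i j *: G i j)) -
  fs (fun i => (a i * c i) *: fs (fun j => b' i j *: G' i j)).
Proof.
move=> fG fG'; rewrite -fsB; try by apply: fin1Z; apply: fin2_fs; apply: fin2Z.
by apply: eq_fs => i; rewrite scalerBr scalerA.
Qed.

Lemma fs_binS k (G : nat -> V) : fin1 G ->
  fs (fun i => C (k + 1) i *: G i) =
  fs (fun i => C k i *: G i) + fs (fun i => C k i *: G i.+1).
Proof.
move=> fG; have fG' : fin1 (fun i => G i.+1).
  by case: fG => N h; exists N => i ?; apply: h; lia.
rewrite fs_recl; last exact: fin1Z.
rewrite [fs (fun i => C k i *: G i)]fs_recl; last exact: fin1Z.
rewrite !gbin0 -addrA -fsD; try exact: fin1Z; try exact: (fin1Z (fun i => C k i.+1)).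
by congr (_ + _); apply: eq_fs => i; rewrite -scalerDl gbin_pascal.
Qed.

Lemma fs_sbinS k (G : nat -> V) : fin1 G ->
  fs (fun i => S (k + 1) i *: G i) =
  fs (fun i => S k i *: G i) - fs (fun i => S k i *: G i.+1).
Proof.
move=> fG; have fG' : fin1 (fun i => G i.+1).
  by case: fG => N h; exists N => i ?; apply: h; lia.
rewrite fs_recl; last exact: fin1Z.
rewrite [fs (fun i => S k i *: G i)]fs_recl; last exact: fin1Z.
rewrite /sbin !gbin0 -addrA -fsB; try exact: fin1Z;
  try exact: (fin1Z (fun i => S k i.+1)).
by congr (_ + _); apply: eq_fs => i; rewrite -scalerBl -sbin_pascal.
Qed.

Lemma fs_bin0 (G : nat -> V) : fs (fun i => C 0 i *: G i) = G 0.
Proof.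
rewrite fs_only0 ?gbin0 ?scale1r // => i.
by rewrite gbin0n scale0r.
Qed.

Lemma fs_sbin0 (G : nat -> V) : fs (fun i => S 0 i *: G i) = G 0.
Proof.
rewrite fs_only0 => [|i]; first by rewrite /sbin expr0 mul1r gbin0 scale1r.
by rewrite /sbin gbin0n mulr0 scale0r.
Qed.

Lemma borcherds0 a f k n w : borcherds a f 0 k n w = a k (f n w) - f n (a k w).
Proof.
rewrite /borcherds !fs_sbin0 /gsgn expr0 scale1r.
by congr (a _ (f _ w) - f _ (a _ w)); lia.
Qed.

Lemma gsgn1 l : sg (l + 1) = - sg l.
Proof. by rewrite gsgnD /gsgn expr1 mulrN1. Qed.

(** Raising [l] by 1 multiplies the kernel (x_0 - y_0)^l, in either expansion, by x_0 - y_0; the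
    factor x_0 raises the mode of [a], the factor y_0 that of [f]. *)
Lemma borcherds_pascal a f l k n w : field a -> field f ->
  borcherds a f (l + 1) k n w = borcherds a f l (k + 1) n w - borcherds a f l k (n + 1) w.
Proof.
move=> ha hf; rewrite /borcherds gsgn1.
rewrite (@fs_sbinS l); last first.
  apply: (linmap_fin1 (g := fun i => a (l + 1 + k - i%:Z))); first by case: ha.
  exact: field_fin1.
rewrite (@fs_sbinS l (fun i => f _ _)); last first.
  apply: (linmap_fin1 (g := fun i => f (n + (l + 1) - i%:Z))); first by case: hf.
  exact: field_fin1.
rewrite scaleNr opprK scalerBr.
rewrite opprB addrACA [RHS]addrACA [- (sg l *: _) - _]addrC.
congr (_ + _ *: _ + (- _ - _ *: _)); apply: eq_fs => i; congr (_ *: _).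
- by congr (a _ _); lia.
- by congr (f _ _); lia.
- by congr (a _ (f _ _)); lia.
by congr (f _ (a _ _)); lia.
Qed.

(** In the applications [X k] is the field of u_k v, which is zero as soon as u_k v is; hence a
    bound independent of [n] and [w]. *)
Definition lower_trunc (X : int -> int -> V -> V) :=
  exists N : int, forall k, N <= k -> forall n w, X k n w = 0.

(* By Pascal's rule both sides of the Borcherds identity satisfy the recursion
   [E (l + 1) k n = E l (k + 1) n - E l k (n + 1)], so the cases l = 0
   (commutator) and k = 0 (associativity) imply all the others. *)
Lemma borcherds_full a f (X : int -> int -> V -> V) : field a -> field f ->
  lower_trunc X ->
  (forall k n w, a k (f n w) - f n (a k w) =
     fs (fun i => C k i *: X i%:Z (k + n - i%:Z) w)) ->
  (forall l n w, X l n w = borcherds a f l 0 n w) ->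
  forall l k n w,
    fs (fun i => C k i *: X (l + i%:Z) (k + n - i%:Z) w) = borcherds a f l k n w.
Proof.
move=> ha hf [N hN] comm assoc.
pose L l k n w := fs (fun i => C k i *: X (l + i%:Z) (k + n - i%:Z) w).
have L_pascal l k n w : L (l + 1) k n w = L l (k + 1) n w - L l k (n + 1) w.
  have e : L l k (n + 1) w = fs (fun i => C k i *: X (l + i%:Z) (k + 1 + n - i%:Z) w).
    by apply: eq_fs => i; congr (_ *: X _ _ _); lia.
  rewrite e /L fs_binS; last by exists `|N - l|%N => i hi; apply: hN; lia.
  rewrite addrAC subrr add0r; apply: eq_fs => i.
  by congr (_ *: X _ _ _); lia.
have Lnat (l : nat) k n w : L l%:Z k n w = borcherds a f l%:Z k n w.
  elim: l k n => [|l IH] k n.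
    rewrite borcherds0 comm; apply: eq_fs => i.
    by congr (_ *: X _ _ _); lia.
  have -> : Posz l.+1 = l%:Z + 1 by lia.
  by rewrite L_pascal borcherds_pascal // !IH.
move=> l k n w; rewrite -/(L l k n w).
elim/int_ind2: k l n => [|k IH|k IH] l n.
- by rewrite /L fs_bin0 assoc; congr (borcherds _ _ _ _ _ _); lia.
- have := L_pascal l k n w; rewrite !IH borcherds_pascal // => h.
  by apply: (addIr (- borcherds a f l k (n + 1) w)); rewrite -h.
(* Downward in [k] the recursion reads E l k (n + 1) = E l (k + 1) n - E (l + 1) k n. It moves a
   negative [l] towards 0, where [Lnat] takes over. *)
have H (j : nat) l' n' : `|l'|%N = j -> L l' k n' w = borcherds a f l' k n' w.
  elim: j l' n' => [|j IHj] [l'|l'] n' hl; rewrite ?Lnat //.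
  have := L_pascal (Negz l') k (n' - 1) w.
  rewrite IH subrK IHj; last by lia.
  rewrite borcherds_pascal // subrK => /addrI /oppr_inj; exact.
exact: (H `|l|%N).
Qed.

Lemma fs_linB (g : V -> V) (a c : nat -> F) (d : F) (X Y : nat -> V) :
  linmap g -> fin1 X -> fin1 Y ->
  g (fs (fun i => a i *: X i) - d *: fs (fun i => c i *: Y i)) =
  fs (fun i => a i *: g (X i)) - d *: fs (fun i => c i *: g (Y i)).
Proof.
move=> lg fX fY; rewrite (linmapB lg) (linmapZ lg).
by rewrite (fs_linZ _ lg fX) (fs_linZ _ lg fY).
Qed.

(** * The Jacobi identity passes from u to b_m u *)

(* [uv i n], [bv j n], [b_uv i j n], [u_bv i j n], [bu n], [bu_v i n] are the modes of index
   [n] of [Y (u_i v)], [Y (b_j v)], [Y (b_i (u_j v))], [Y (u_i (b_j v))], [Y (b_m u)] and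
   [Y ((b_m u)_i v)]. *)
Section Associator.
Variables (b u v bu : int -> V -> V) (uv : int -> int -> V -> V).
Variables (bv : nat -> int -> V -> V) (b_uv : int -> int -> int -> V -> V).
Variables (u_bv : int -> nat -> int -> V -> V) (bu_v : int -> int -> V -> V) (m : int).
Hypotheses (fb : field b) (fu : field u) (fv : field v).
Hypotheses (fuv : forall i, field (uv i)) (fbv : forall j, field (bv j)).
Hypothesis uv_trunc : lower_trunc uv.
Hypothesis bv_trunc : exists N, forall j, (N <= j)%N -> forall n w, bv j n w = 0.
Hypothesis u_bv_trunc : forall j, lower_trunc (u_bv^~ j).
Hypothesis u_bv_trunc2 :
  exists N, forall j, (N <= j)%N -> forall i n w, u_bv i j n w = 0.
Hypothesis bu_def : forall n w, bu n w = borcherds b u m 0 n w.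
Hypothesis bu_v_def : forall i n w, bu_v i n w =
  fs (fun j => S m j *: b_uv (m - j%:Z) (i + j%:Z) n w) -
  sg m *: fs (fun j => S m j *: u_bv (i + m - j%:Z) j n w).
Hypothesis b_uv_def : forall i j n w, b_uv i j n w = borcherds b (uv j) i 0 n w.
Hypothesis J_uv : forall l k n w,
  fs (fun i => C k i *: uv (l + i%:Z) (k + n - i%:Z) w) = borcherds u v l k n w.
Hypothesis J_u_bv : forall j l k n w,
  fs (fun i => C k i *: u_bv (l + i%:Z) j (k + n - i%:Z) w) = borcherds u (bv j) l k n w.
Hypothesis bv_comm : forall k n w,
  b k (v n w) - v n (b k w) = fs (fun j => C k j *: bv j (k + n - j%:Z) w).

Lemma fin_uv i0 n w : fin1 (fun i => uv (i0 + i%:Z) (n - i%:Z) w).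
Proof.
by case: uv_trunc => N h; exists `|N - i0|%N => i hi; apply: h; lia.
Qed.

(** Expanding (b_m u)_i v gives b (u_i v) and u_i (b_j v). The field of the former contributes [A1],
    with b on the left, and [A2], with b on the right; the latter contributes [A3]. *)
Let A1 l k n w := fs (fun i => C k i *: fs (fun j => S m j *:
  fs (fun t => S (m - j%:Z) t *:
    b (m - (j + t)%N%:Z) (uv (l + (i + j)%N%:Z) (k + n + (j + t)%N%:Z - (i + j)%N%:Z) w)))).
Let A2 l k n w := fs (fun i => C k i *: fs (fun j => (S m j * sg (m - j%:Z)) *:
  fs (fun t => S (m - j%:Z) t *:
    uv (l + (i + j)%N%:Z) (k + n + m - t%:Z - (i + j)%N%:Z) (b t%:Z w)))).
Let A3 l k n w := fs (fun i => C k i *: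
  fs (fun j => S m j *: u_bv (l + i%:Z + m - j%:Z) j (k + n - i%:Z) w)).

Let HA1 l k n w q i := b (m - q%:Z) (uv (l + i%:Z) (k + n + q%:Z - i%:Z) w).
Let HA2 l k n w t i := uv (l + i%:Z) (k + n + m - t%:Z - i%:Z) (b t%:Z w).

Lemma fin_HA1 l k n w : fin2 (HA1 l k n w).
Proof.
apply: fin2C; apply: fin2I => [|i].
  case: uv_trunc => N h; exists `|N - l|%N => i q hi; rewrite /HA1 h ?field0 //.
  by lia.
apply: (linmap_fin1 (g := fun q => b (m - q%:Z))); first by case: fb.
have [N h] := field_trunc (k + n - i%:Z) w (fuv (l + i%:Z)).
by exists N => q /h <-; congr (uv _ _ _); lia.
Qed.

Lemma fin_HA2 l k n w : fin2 (HA2 l k n w).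
Proof.
apply: fin2I => [|t].
  have [N h] := field_trunc 0 w fb.
  by exists N => t i /h; rewrite /HA2 add0r => ->; exact: field0.
exact: (fin_uv l (k + n + m - t%:Z) (b t%:Z w)).
Qed.

Lemma fin_tri (H : nat -> nat -> V) i (x : nat -> nat -> nat) (y : nat -> nat -> nat) :
  fin2 H -> (forall j t, (j + t <= i + x j t + y j t)%N) ->
  fin2 (fun j t => H (x j t) (y j t)).
Proof.
move=> [N h] hxy; exists (N + i)%N => j t hjt; apply: h.
by have := hxy j t; lia.
Qed.

Lemma bu_v_expand l k n w :
  fs (fun i => C k i *: bu_v (l + i%:Z) (k + n - i%:Z) w) =
  A1 l k n w - A2 l k n w - sg m *: A3 l k n w.
Proof.
pose x i := fs (fun j => S m j *: fs (fun t => S (m - j%:Z) t *: HA1 l k n w (j + t)%N (i + j)%N)).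
pose y i := fs (fun j => (S m j * sg (m - j%:Z)) *:
  fs (fun t => S (m - j%:Z) t *: HA2 l k n w t (i + j)%N)).
pose z i := fs (fun j => S m j *: u_bv (l + i%:Z + m - j%:Z) j (k + n - i%:Z) w).
have fx : fin1 x.
  have [N h] := @fin_HA1 l k n w; exists N => i hi; apply: fs_eq0 => j.
  by rewrite fs_eq0 ?scaler0 // => t; rewrite h ?scaler0 //; lia.
have fy : fin1 y.
  have [N h] := @fin_HA2 l k n w; exists N => i hi; apply: fs_eq0 => j.
  by rewrite fs_eq0 ?scaler0 // => t; rewrite h ?scaler0 //; lia.
have fz : fin1 z.
  have [N h] : fin2 (fun j i => u_bv (l + i%:Z + m - j%:Z) j (k + n - i%:Z) w).
    apply: fin2I => [|j].
      by case: u_bv_trunc2 => N h; exists N => j i /h.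
    case: (u_bv_trunc j) => N h; exists (absz (N - l - m + j%:Z)) => i hi; apply: h; lia.
  by exists N => i hi; apply: fs_eq0 => j; rewrite h ?scaler0 //; lia.
have -> : A1 l k n w - A2 l k n w - sg m *: A3 l k n w =
  fs (fun i => C k i *: (x i - y i - sg m *: z i)).
  rewrite -fsZ -!fsB; last first.
  - exact: fin1Z.
  - exact: fin1Z.
  - by apply: (fin1Z (fun i => sg m)); exact: fin1Z.
  - by apply: fin1D; [exact: fin1Z|apply: fin1N; exact: fin1Z].
  apply: eq_fs => i; rewrite !scalerBr; congr (_ - _ - _).
  by rewrite !scalerA mulrC.
apply: eq_fs => i; congr (_ *: _); rewrite bu_v_def; congr (_ - _).
rewrite -fs_split2; last 2 first.
- by apply: (@fin_tri _ i _ _ (@fin_HA1 l k n w)) => j t; lia.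
- by apply: (@fin_tri _ i _ _ (@fin_HA2 l k n w)) => j t; lia.
apply: eq_fs => j; congr (_ *: _); rewrite b_uv_def /borcherds.
congr (_ - _ *: _); apply: eq_fs => t; congr (_ *: _).
  by rewrite /HA1; congr (b _ (uv _ _ _)); lia.
by rewrite /HA2 add0r; congr (uv _ _ _); lia.
Qed.

Lemma fin_buv (k0 n : int) w :
  fin2 (fun q s : nat => b (m - q%:Z) (u (k0 + q%:Z - s%:Z) (v (n + s%:Z) w))).
Proof.
apply: fin2C; apply: fin2I => [|s].
  have [N h] := field_trunc n w fv.
  by exists N => s q /h ->; rewrite !field0.
apply: (linmap_fin1 (g := fun q => b (m - q%:Z))); first by case: fb.
have [N h] := field_trunc (k0 - s%:Z) (v (n + s%:Z) w) fu.
by exists N => q /h <-; congr (u _ _); lia.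
Qed.

Lemma fin_bvu (k0 n : int) w :
  fin2 (fun q s : nat => b (m - q%:Z) (v (n - s%:Z) (u (k0 + q%:Z + s%:Z) w))).
Proof.
have [N h] := field_trunc k0 w fu.
exists N => q s hqs; rewrite (_ : _ + s%:Z = k0 + (q + s)%N%:Z); last by lia.
by rewrite h ?field0.
Qed.

Lemma fin_vbu (k0 n : int) w :
  fin2 (fun q s : nat => v (n - s%:Z) (b (m - q%:Z) (u (k0 + q%:Z + s%:Z) w))).
Proof.
have [N h] := field_trunc k0 w fu.
exists N => q s hqs; rewrite (_ : _ + s%:Z = k0 + (q + s)%N%:Z); last by lia.
by rewrite h ?field0.
Qed.

Lemma fin_uvb (k0 n : int) w :
  fin2 (fun q s : nat => u (k0 - q%:Z - s%:Z) (v (n + s%:Z) (b q%:Z w))).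
Proof.
apply: fin2I => [|q].
  have [N h] := field_trunc 0 w fb.
  by exists N => q s /h; rewrite add0r => ->; rewrite !field0.
have [N h] := field_trunc n (b q%:Z w) fv.
by exists N => s /h ->; rewrite field0.
Qed.

Lemma fin_vub (k0 n : int) w :
  fin2 (fun q s : nat => v (n - s%:Z) (u (k0 - q%:Z + s%:Z) (b q%:Z w))).
Proof.
apply: fin2I => [|q].
  have [N h] := field_trunc 0 w fb.
  by exists N => q s /h; rewrite add0r => ->; rewrite !field0.
have [N h] := field_trunc (k0 - q%:Z) (b q%:Z w) fu.
by exists N => s /h ->; rewrite field0.
Qed.

Lemma fin_ubv (k0 n : int) w :
  fin2 (fun q s : nat => u (k0 - q%:Z - s%:Z) (b q%:Z (v (n + s%:Z) w))).
Proof.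
apply: fin2C; apply: fin2I => [|s].
  have [N h] := field_trunc n w fv.
  by exists N => q s /h ->; rewrite !field0.
have [N h] := field_trunc 0 (v (n + s%:Z) w) fb.
by exists N => q /h; rewrite add0r => ->; rewrite field0.
Qed.

Lemma fin_u_bv (k0 n : int) w :
  fin2 (fun j s : nat => u (k0 - j%:Z - s%:Z) (bv j (n + s%:Z) w)).
Proof.
apply: fin2I => [|j].
  by have [N h] := bv_trunc; exists N => j s /h ->; rewrite field0.
have [N h] := field_trunc n w (fbv j).
by exists N => s /h ->; rewrite field0.
Qed.

Lemma fin_bv_u (k0 n : int) w :
  fin2 (fun j s : nat => bv j (k0 - j%:Z - s%:Z) (u (n + s%:Z) w)).
Proof.
apply: fin2I => [|j].
  by have [N h] := bv_trunc; exists N => j s /h ->.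
have [N h] := field_trunc n w fu.
by exists N => s /h ->; rewrite field0.
Qed.

(** Operator orders: [B1] to [B4] are b u v, b v u, u v b, v u b; [B5] and [B6] are u (b_j v) and
    (b_j v) u; [C2] and [C3] are u b v and v b u. *)
Let B1 l k n w := fs (fun q => S m q *: fs (fun s => S l s *:
  b (m - q%:Z) (u (l + k + q%:Z - s%:Z) (v (n + s%:Z) w)))).
Let B2 l k n w := fs (fun q => S m q *: fs (fun s => S l s *:
  b (m - q%:Z) (v (n + l - s%:Z) (u (k + q%:Z + s%:Z) w)))).
Let B3 l k n w := fs (fun q => S m q *: fs (fun s => S l s *:
  u (l + k + m - q%:Z - s%:Z) (v (n + s%:Z) (b q%:Z w)))).
Let B4 l k n w := fs (fun q => S m q *: fs (fun s => S l s *: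
  v (n + l - s%:Z) (u (k + m - q%:Z + s%:Z) (b q%:Z w)))).
Let B5 l k n w := fs (fun j => S m j *: fs (fun s => S (l + m - j%:Z) s *:
  u (l + k + m - j%:Z - s%:Z) (bv j (n + s%:Z) w))).
Let B6 l k n w := fs (fun j => C m j *: fs (fun s => S (l + m - j%:Z) s *:
  bv j (n + l + m - j%:Z - s%:Z) (u (k + s%:Z) w))).
Let C2 l k n w := fs (fun q => S m q *: fs (fun s => S l s *:
  u (l + k + m - q%:Z - s%:Z) (b q%:Z (v (n + s%:Z) w)))).
Let C3 l k n w := fs (fun q => S m q *: fs (fun s => S l s *:
  v (n + l - s%:Z) (b (m - q%:Z) (u (k + q%:Z + s%:Z) w)))).

Lemma A1E l k n w : A1 l k n w = B1 l k n w - sg l *: B2 l k n w.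
Proof.
rewrite /A1 (fs_tri1 k m (@fin_HA1 l k n w)) -fsZ.
under [fs (fun i => sg l *: _)]eq_fs => i do rewrite scalerA mulrC.
rewrite -(fs_split2 _ (fun=> sg l)); last 2 first.
- exact: fin_buv.
- exact: fin_bvu.
apply: eq_fs => q; congr (_ *: _).
rewrite /HA1 -(fs_linZ (f := b (m - q%:Z))); last 2 first.
- exact: field_lin.
- exact: fin_uv.
have -> : fs (fun i => C (k + q%:Z) i *: uv (l + i%:Z) (k + n + q%:Z - i%:Z) w)
    = borcherds u v l (k + q%:Z) n w.
  by rewrite -J_uv; apply: eq_fs => i; congr (_ *: uv _ _ _); lia.
rewrite /borcherds fs_linB.
- congr (_ - _); apply: eq_fs => s; congr (_ *: b _ (u _ _)); lia.
- exact: field_lin.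
- by apply: (linmap_fin1 (g := fun i => u (l + (k + q%:Z) - i%:Z))); [case: fu|exact: field_fin1].
by apply: (linmap_fin1 (g := fun i => v (n + l - i%:Z))); [case: fv|exact: field_fin1].
Qed.

Lemma A2E l k n w : A2 l k n w = sg m *: (B3 l k n w - sg l *: B4 l k n w).
Proof.
rewrite /A2 (fs_tri2 k m (@fin_HA2 l k n w)); congr (_ *: _); rewrite -fsZ.
under [fs (fun i => sg l *: _)]eq_fs => i do rewrite scalerA mulrC.
rewrite -(fs_split2 _ (fun=> sg l)); last 2 first.
- exact: fin_uvb.
- exact: fin_vub.
apply: eq_fs => q; congr (_ *: _).
have -> : fs (fun i => C (k + m - q%:Z) i *: HA2 l k n w q i)
    = borcherds u v l (k + m - q%:Z) n (b q%:Z w).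
  by rewrite -J_uv; apply: eq_fs => i; congr (_ *: uv _ _ _); lia.
rewrite /borcherds; congr (_ - _); apply: eq_fs => s; congr (_ *: u _ _); lia.
Qed.

Lemma A3E l k n w : A3 l k n w = B5 l k n w - sg (l + m) *: B6 l k n w.
Proof.
rewrite /A3 fs_scale_swap; last first.
  apply: fin2C; apply: fin2I => [|j].
    by case: u_bv_trunc2 => N h; exists N => j i /h.
  case: (u_bv_trunc j) => N h.
  by exists (absz (N - l - m + j%:Z)) => i hi; apply: h; lia.
rewrite -fsZ.
(* Moving (-1)^j from [sg (l + m)] to the binomial coefficient turns the [C m j] of [B6] into
   [S m j] and leaves [sg (l + m - j)], the sign of a Borcherds expression at level [l + m - j]. *)
rewrite [fs (fun i => sg (l + m) *: _)](_ : _ =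
  fs (fun j => (S m j * sg (l + m - j%:Z)) *: fs (fun s => S (l + m - j%:Z) s *:
  bv j (n + l + m - j%:Z - s%:Z) (u (k + s%:Z) w)))); last first.
  apply: eq_fs => j; rewrite scalerA -(gsgn_split F (l + m) j) /sbin.
  by congr (_ *: _); ring.
rewrite -fs_split2; last 2 first.
- exact: fin_u_bv.
- exact: fin_bv_u.
apply: eq_fs => j; congr (_ *: _).
have -> : fs (fun i => C k i *: u_bv (l + i%:Z + m - j%:Z) j (k + n - i%:Z) w)
    = borcherds u (bv j) (l + m - j%:Z) k n w.
  by rewrite -J_u_bv; apply: eq_fs => i; congr (_ *: u_bv _ _ _ _); lia.
rewrite /borcherds; congr (_ - _ *: _); apply: eq_fs => s.
  by congr (_ *: u _ _); lia.
by congr (_ *: bv _ _ _); lia.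
Qed.

(** This is [b, v] u. The mode of b is [m - q], so the commutator brings in [C (m - q) j], the
    pattern of [fs_tri3]. *)
Lemma comm_left l k n w : B2 l k n w - C3 l k n w = B6 l k n w.
Proof.
pose H j s := bv j (n + l + m - j%:Z - s%:Z) (u (k + s%:Z) w).
have fH : fin2 H by exact: fin_bv_u.
rewrite /B6 -(fs_tri3 l m fH) /B2 /C3 -fsB; try by apply/fin1Z/fin2_fs/fin2Z;
  [exact: fin_bvu || exact: fin_vbu].
apply: eq_fs => q; rewrite -scalerBr; congr (_ *: _).
rewrite -fsB; try by apply/fin1Z; [exact: (fin2_fin1 q (fin_bvu _ _ _))
  || exact: (fin2_fin1 q (fin_vbu _ _ _))].
apply: eq_fs => s; rewrite -scalerBr bv_comm; congr (_ *: _).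
apply: eq_fs => j; congr (_ *: _); rewrite /H.
have -> : m - q%:Z + (n + l - s%:Z) - j%:Z = n + l + m - j%:Z - (q + s)%N%:Z by lia.
by congr (bv _ _ (u _ _)); lia.
Qed.

(** This is u [b, v]. Here b has mode [q >= 0], so the commutator brings in [C q j], the pattern of
    [fs_tri4]. *)
Lemma comm_right l k n w : C2 l k n w - B3 l k n w = B5 l k n w.
Proof.
pose H j x := u (l + k + m - x%:Z) (bv j (n - j%:Z + x%:Z) w).
have fH : fin2 H.
  apply: fin2I => [|j].
    by have [N h] := bv_trunc; exists N => j s /h h'; rewrite /H h' field0.
  have [N h] := field_trunc (n - j%:Z) w (fbv j).
  by exists N => s /h h'; rewrite /H h' field0.
transitivity (fs (fun j => S m j *: fs (fun I => S (l + m - j%:Z) I *: H j (I + j)%N))).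
  rewrite -(fs_tri4 l m fH) /C2 /B3 fs_scale_swap; last exact: fin_ubv.
  rewrite [X in _ - X]fs_scale_swap; last exact: fin_uvb.
  rewrite -fsB; try by apply/fin1Z/fin2_fs/fin2Z/fin2C;
    [exact: fin_ubv || exact: fin_uvb].
  apply: eq_fs => s; rewrite -scalerBr; congr (_ *: _).
  rewrite -fsB; try by apply/fin1Z; [exact: (fin2_fin1 s (fin2C (fin_ubv _ _ _)))
    || exact: (fin2_fin1 s (fin2C (fin_uvb _ _ _)))].
  apply: eq_fs => q; rewrite -scalerBr; congr (_ *: _).
  rewrite -(linmapB (field_lin _ fu)) bv_comm fs_linZ; last 2 first.
  - exact: field_lin.
  - by have [N h] := bv_trunc; exists N => j /h ->.
  by apply: eq_fs => j; congr (_ *: u _ (bv _ _ _)); lia.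
apply: eq_fs => j; congr (_ *: _); apply: eq_fs => s; congr (_ *: u _ (bv _ _ _)); lia.
Qed.

Lemma borcherds_bu l k n w : borcherds bu v l k n w =
  B1 l k n w - sg m *: C2 l k n w - sg l *: (C3 l k n w - sg m *: B4 l k n w).
Proof.
rewrite /B1 /C2 /C3 /B4 /borcherds; congr (_ - _ *: _).
  rewrite fs_scale_swap; last exact: fin_buv.
  rewrite [X in _ - _ *: X]fs_scale_swap; last exact: fin_ubv.
  rewrite -fsZ; under [fs (fun i => sg m *: _)]eq_fs => i do rewrite scalerA mulrC.
  rewrite -(fs_split2 _ (fun=> sg m)); last 2 first.
  - by apply: fin2C; exact: fin_buv.
  - by apply: fin2C; exact: fin_ubv.
  apply: eq_fs => s; congr (_ *: _); rewrite bu_def /borcherds.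
  congr (_ - _ *: _); apply: eq_fs => q; congr (_ *: _).
    by congr (b _ (u _ _)); lia.
  by rewrite add0r; congr (u _ _); lia.
rewrite fs_scale_swap; last exact: fin_vbu.
rewrite [X in _ - _ *: X]fs_scale_swap; last exact: fin_vub.
rewrite -fsZ; under [fs (fun i => sg m *: _)]eq_fs => i do rewrite scalerA mulrC.
rewrite -(fs_split2 _ (fun=> sg m)); last 2 first.
- by apply: fin2C; exact: fin_vbu.
- by apply: fin2C; exact: fin_vub.
apply: eq_fs => s; congr (_ *: _); rewrite bu_def /borcherds.
rewrite fs_linB.
- congr (_ - _ *: _); apply: eq_fs => q; congr (_ *: v _ _).
    by congr (b _ (u _ _)); lia.
  by rewrite add0r; congr (u _ _); lia.
- exact: field_lin.
- apply: (linmap_fin1 (g := fun i => b (m + 0 - i%:Z))); first by case: fb.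
  exact: field_fin1.
apply: (linmap_fin1 (g := fun i => u (k + s%:Z + m - i%:Z))); first by case: fu.
exact: field_fin1.
Qed.

(** Both sides contain b u v and v u b. The left has b v u and u v b where the right has v b u and u
    b v; the two differences are commutators of b and v, and they are exactly the terms [B6] and
    [B5] coming from b_j v. *)
Lemma borcherds_assoc l k n w :
  fs (fun i => C k i *: bu_v (l + i%:Z) (k + n - i%:Z) w) = borcherds bu v l k n w.
Proof.
rewrite bu_v_expand borcherds_bu A1E A2E A3E -comm_left -comm_right gsgnD.
rewrite !scalerBr !scalerA [sg m * (_ * _)]mulrCA gsgn_sqr mulr1 mulrC.
move: (B1 _ _ _ _) (sg l *: B2 _ _ _ _) (sg l *: C3 _ _ _ _) => x1 x2 y3.
move: (sg m *: B3 _ _ _ _) (sg m *: C2 _ _ _ _) => x3 y2; rewrite !opprB.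
move: (_ *: B4 _ _ _ _) => x4.
rewrite addrACA (addrA (x1 - x2)) subrK (addrA (x4 - x3)) subrK.
by rewrite addrACA [RHS]addrACA [- y3 - y2]addrC.
Qed.
End Associator.

(** * The commutator formula passes from v to b_l v *)

(* [bv n], [av j n], [ab j n], [a_bv j n], [b_av j n], [ab_v j i n] are the modes of index
   [n] of [Y (b_l v)], [Y (a_j v)], [Y (a_j b)], [Y (a_j (b_l v))], [Y (b_l (a_j v))] and
   [Y ((a_j b)_i v)]. *)
Section Commutator.
Variables (a b v bv : int -> V -> V) (av ab a_bv b_av : nat -> int -> V -> V).
Variables (ab_v : nat -> int -> int -> V -> V) (l : int).
Hypotheses (fa : field a) (fb : field b) (fv : field v).
Hypotheses (fav : forall j, field (av j)) (fab : forall j, field (ab j)).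
Hypothesis av_trunc : exists N, forall j, (N <= j)%N -> forall n w, av j n w = 0.
Hypothesis ab_trunc : exists N, forall j, (N <= j)%N -> forall n w, ab j n w = 0.
Hypothesis ab_v_trunc : forall j, lower_trunc (ab_v j).
Hypothesis ab_v_trunc2 :
  exists N, forall j, (N <= j)%N -> forall i n w, ab_v j i n w = 0.
Hypothesis bv_def : forall n w, bv n w = borcherds b v l 0 n w.
Hypothesis a_bv_def : forall i n w, a_bv i n w =
  b_av i n w + fs (fun j => C i%:Z j *: ab_v j (l + i%:Z - j%:Z) n w).
Hypothesis b_av_def : forall i n w, b_av i n w = borcherds b (av i) l 0 n w.
Hypothesis av_comm : forall k n w,
  a k (v n w) - v n (a k w) = fs (fun i => C k i *: av i (k + n - i%:Z) w).
Hypothesis ab_comm : forall k n w,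
  a k (b n w) - b n (a k w) = fs (fun j => C k j *: ab j (k + n - j%:Z) w).
Hypothesis J_ab_v : forall j l k n w,
  fs (fun i => C k i *: ab_v j (l + i%:Z) (k + n - i%:Z) w) = borcherds (ab j) v l k n w.

Lemma fin_ab_v k n w :
  fin2 (fun i j => ab_v j (l + i%:Z - j%:Z) (k + n - i%:Z) w).
Proof.
apply: fin2C; apply: fin2I => [|j].
  by case: ab_v_trunc2 => N h; exists N => j i /h.
case: (ab_v_trunc j) => N h.
by exists (absz (N - l + j%:Z)) => i hi; apply: h; lia.
Qed.

(** By trinomial revision C(k, j) C(k - j, i) = C(k, i + j) C(i + j, j), so the Jacobi identities of
    the a_j b with v collect into the difference a_i (b_l v) - b_l (a_i v) of [a_bv_def]. *)
Lemma ab_v_resum k n w :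
  fs (fun j => C k j *: borcherds (ab j) v l (k - j%:Z) n w) =
  fs (fun i => C k i *: fs (fun j => C i%:Z j *: ab_v j (l + i%:Z - j%:Z) (k + n - i%:Z) w)).
Proof.
under [RHS]eq_fs => i do rewrite -fsZ.
rewrite [RHS]fs_swap; last by do 2 apply: fin2Z; exact: fin_ab_v.
apply: eq_fs => j; rewrite [RHS](@fs_shift _ _ j); last first.
  by move=> i ij; rewrite gbin_small // scale0r scaler0.
rewrite -J_ab_v -fsZ; apply: eq_fs => i; rewrite !scalerA gbin_trinomial.
by congr (_ *: ab_v _ _ _ _); lia.
Qed.

Lemma fin_ab_of_v k0 n w :
  fin2 (fun i j : nat => ab j (k0 - i%:Z - j%:Z) (v (n + i%:Z) w)).
Proof.
apply: fin2I => [|i].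
  have [N h] := field_trunc n w fv.
  by exists N => i j /h ->; rewrite field0.
by have [N h] := ab_trunc; exists N => j /h.
Qed.

Lemma fin_v_of_ab k0 n w :
  fin2 (fun i j : nat => v (n - i%:Z) (ab j (k0 + i%:Z - j%:Z) w)).
Proof.
apply: fin2C; apply: fin2I => [|j].
  by have [N h] := ab_trunc; exists N => j i /h ->; rewrite field0.
have [N h] := field_trunc (k0 - j%:Z) w (fab j).
by exists N => i /h; rewrite addrAC => ->; rewrite field0.
Qed.

Lemma fin_b_of_av k0 n w :
  fin2 (fun i j : nat => b (n - i%:Z) (av j (k0 + i%:Z - j%:Z) w)).
Proof.
apply: fin2C; apply: fin2I => [|j].
  by have [N h] := av_trunc; exists N => j i /h ->; rewrite field0.
have [N h] := field_trunc (k0 - j%:Z) w (fav j).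
by exists N => i /h; rewrite addrAC => ->; rewrite field0.
Qed.

Lemma fin_av_of_b k0 n w :
  fin2 (fun i j : nat => av j (k0 - i%:Z - j%:Z) (b (n + i%:Z) w)).
Proof.
apply: fin2I => [|i].
  have [N h] := field_trunc n w fb.
  by exists N => i j /h ->; rewrite field0.
by have [N h] := av_trunc; exists N => j /h.
Qed.

(** Commutation with a_k is a derivation on the products b v and v b. The terms with a_j b ([P1],
    [Q2]) form the Borcherds expressions of a_j b and v, those with a_j v ([P2], [Q1]) the ones of b
    and a_j v. *)
Lemma comm_bv k n w : a k (bv n w) - bv n (a k w) =
  fs (fun i => C k i *: a_bv i (k + n - i%:Z) w).
Proof.
have fin_bv n' w' : fin1 (fun i : nat => b (l + 0 - i%:Z) (v (n' + i%:Z) w')).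
  by apply: (linmap_fin1 (g := fun i => b (l + 0 - i%:Z))); [case: fb|exact: field_fin1].
have fin_vb n' w' : fin1 (fun i : nat => v (n' + l - i%:Z) (b (0 + i%:Z) w')).
  by apply: (linmap_fin1 (g := fun i => v (n' + l - i%:Z))); [case: fv|exact: field_fin1].
rewrite !bv_def /borcherds fs_linB; [|exact: field_lin|exact: fin_bv|exact: fin_vb].
rewrite opprB addrACA [- _ + _]addrC addrACA -scalerBr.
have fin_abv : fin1 (fun i : nat => a k (b (l + 0 - i%:Z) (v (n + i%:Z) w))).
  by case: (fin_bv n w) => N h; exists N => i /h ->; exact: field0.
have fin_avb : fin1 (fun i : nat => a k (v (n + l - i%:Z) (b (0 + i%:Z) w))).
  by case: (fin_vb n w) => N h; exists N => i /h ->; exact: field0.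
set X1 := fs _; set X2 := fs _; set X3 := fs _; set X4 := fs _.
pose P1 := fs (fun j => C k j *: fs (fun i => S l i *:
  ab j (k + l - i%:Z - j%:Z) (v (n + i%:Z) w))).
pose P2 := fs (fun j => C k j *: fs (fun i => S l i *:
  b (l - i%:Z) (av j (k + n + i%:Z - j%:Z) w))).
pose Q1 := fs (fun j => C k j *: fs (fun i => S l i *:
  av j (k + n + l - i%:Z - j%:Z) (b (0 + i%:Z) w))).
pose Q2 := fs (fun j => C k j *: fs (fun i => S l i *:
  v (n + l - i%:Z) (ab j (k + i%:Z - j%:Z) w))).
have eP : X1 - X2 = P1 + P2.
  rewrite /X1 /X2 -fsB; [|exact: fin1Z|exact: fin1Z].
  rewrite /P1 /P2 -fs_scale_swap; last exact: fin_ab_of_v.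
  rewrite -[X in _ = _ + X]fs_scale_swap; last exact: fin_b_of_av.
  rewrite -fsD; try by apply/fin1Z/fin2_fs/fin2Z;
    [exact: fin_ab_of_v || exact: fin_b_of_av].
  apply: eq_fs => i; rewrite -scalerBr -scalerDr; congr (_ *: _).
  (* The Leibniz rule a b v - b v a = [a, b] v + b [a, v], through the intermediate term b a v. *)
  rewrite -[LHS](subrKA (b (l + 0 - i%:Z) (a k (v (n + i%:Z) w)))).
  rewrite ab_comm -(linmapB (field_lin _ fb)) av_comm; congr (_ + _).
    by apply: eq_fs => j; congr (_ *: ab _ _ _); lia.
  rewrite fs_linZ; [|exact: field_lin|by have [N h] := av_trunc; exists N => j /h].
  by apply: eq_fs => j; congr (_ *: b _ (av _ _ _)); lia.
have eQ : X4 - X3 = Q1 + Q2.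
  rewrite /X4 /X3 -fsB; [|exact: fin1Z|exact: fin1Z].
  rewrite /Q1 /Q2 -fs_scale_swap; last exact: fin_av_of_b.
  rewrite -[X in _ = _ + X]fs_scale_swap; last exact: fin_v_of_ab.
  rewrite -fsD; try by apply/fin1Z/fin2_fs/fin2Z;
    [exact: fin_av_of_b || exact: fin_v_of_ab].
  apply: eq_fs => i; rewrite -scalerBr -scalerDr; congr (_ *: _).
  rewrite -[LHS](subrKA (v (n + l - i%:Z) (a k (b (0 + i%:Z) w)))).
  rewrite av_comm -(linmapB (field_lin _ fv)) ab_comm; congr (_ + _).
    by apply: eq_fs => j; congr (_ *: av _ _ _); lia.
  rewrite fs_linZ; [|exact: field_lin|by have [N h] := ab_trunc; exists N => j /h].
  by apply: eq_fs => j; congr (_ *: v _ (ab _ _ _)); lia.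
rewrite eP -opprB eQ scalerN scalerDr.
have e1 : P1 - sg l *: Q2 = fs (fun j => C k j *: borcherds (ab j) v l (k - j%:Z) n w).
  rewrite /P1 /Q2 -fsZ.
  under [fs (fun i => sg l *: _)]eq_fs => i do rewrite scalerA mulrC.
  rewrite -(fs_split2 _ (fun=> sg l)); last 2 first.
  - by apply: fin2C; exact: fin_ab_of_v.
  - by apply: fin2C; exact: fin_v_of_ab.
  apply: eq_fs => j; congr (_ *: (_ - _ *: _)); apply: eq_fs => i.
    by congr (_ *: ab _ _ _); lia.
  by congr (_ *: v _ (ab _ _ _)); lia.
have e2 : P2 - sg l *: Q1 = fs (fun j => C k j *: b_av j (k + n - j%:Z) w).
  rewrite /P2 /Q1 -fsZ.
  under [fs (fun i => sg l *: _)]eq_fs => i do rewrite scalerA mulrC.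
  rewrite -(fs_split2 _ (fun=> sg l)); last 2 first.
  - by apply: fin2C; exact: fin_b_of_av.
  - by apply: fin2C; exact: fin_av_of_b.
  apply: eq_fs => j; rewrite b_av_def; congr (_ *: (_ - _ *: _)); apply: eq_fs => i.
    by congr (_ *: b _ (av _ _ _)); lia.
  by congr (_ *: av _ _ _); lia.
rewrite [X in _ - X]addrC opprD addrACA e1 e2 ab_v_resum addrC -fsD.
- by apply: eq_fs => i; rewrite -scalerDr a_bv_def.
- by apply: fin1Z; have [N h] := av_trunc; exists N => j hj; rewrite b_av_def
    /borcherds !fs_eq0 ?scaler0 ?subr0 // => i; rewrite h ?field0 ?scaler0.
by apply/fin1Z/fin2_fs/fin2Z; exact: fin_ab_v.
Qed.
End Commutator.

(** * Linearity and vanishing of Borcherds expressions *)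

Lemma eq_borcherds a a' f f' l k n w : (forall j, a j =1 a' j) ->
  (forall j, f j =1 f' j) -> borcherds a f l k n w = borcherds a' f' l k n w.
Proof.
move=> ea ef; rewrite /borcherds; congr (_ - _ *: _); apply: eq_fs => i.
  by rewrite ea ef.
by rewrite ef ea.
Qed.

Lemma borcherds_fin1l a f l k n w : field a -> field f ->
  fin1 (fun i : nat => a (l + k - i%:Z) (f (n + i%:Z) w)).
Proof.
move=> fa ff; apply: (linmap_fin1 (g := fun i => a (l + k - i%:Z))).
  by case: fa.
exact: field_fin1.
Qed.

Lemma borcherds_fin1r a f l k n w : field a -> field f ->
  fin1 (fun i : nat => f (n + l - i%:Z) (a (k + i%:Z) w)).
Proof.
move=> fa ff; apply: (linmap_fin1 (g := fun i => f (n + l - i%:Z))).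
  by case: ff.
exact: field_fin1.
Qed.

Lemma borcherds_map (g : V -> V) a f l k n w : linmap g -> field a -> field f ->
  g (borcherds a f l k n w) =
  fs (fun i => S l i *: g (a (l + k - i%:Z) (f (n + i%:Z) w))) -
  sg l *: fs (fun i => S l i *: g (f (n + l - i%:Z) (a (k + i%:Z) w))).
Proof.
move=> lg fa ff; rewrite /borcherds fs_linB //.
  exact: (borcherds_fin1l l k n w fa ff).
exact: (borcherds_fin1r l k n w fa ff).
Qed.

Lemma fs_lincomb c (d : nat -> F) (X Y Z : nat -> V) : fin1 X -> fin1 Y ->
  (forall i, Z i = c *: X i + Y i) ->
  fs (fun i => d i *: Z i) = c *: fs (fun i => d i *: X i) + fs (fun i => d i *: Y i).
Proof.
move=> fX fY e; rewrite -fsZ -fsD; last 2 first.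
- by apply: (fin1Z (fun=> c)); exact: fin1Z.
- exact: fin1Z.
by apply: eq_fs => i; rewrite e scalerDr !scalerA mulrC.
Qed.

Lemma lincombB c e (x1 x2 y1 y2 : V) :
  c *: x1 + x2 - e *: (c *: y1 + y2) = c *: (x1 - e *: y1) + (x2 - e *: y2).
Proof.
by rewrite scalerDr opprD addrACA scalerBr !scalerA [e * c]mulrC.
Qed.

Lemma borcherds_linl c a a1 a2 f l k n w : field a1 -> field a2 -> field f ->
  (forall j x, a j x = c *: a1 j x + a2 j x) ->
  borcherds a f l k n w = c *: borcherds a1 f l k n w + borcherds a2 f l k n w.
Proof.
move=> f1 f2 ff e; rewrite /borcherds -lincombB; congr (_ - _ *: _).
  apply: fs_lincomb => [||i]; last by rewrite e.
  - exact: (borcherds_fin1l l k n w f1 ff).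
  - exact: (borcherds_fin1l l k n w f2 ff).
apply: fs_lincomb => [||i]; last by rewrite e (field_lin _ ff).
- exact: (borcherds_fin1r l k n w f1 ff).
- exact: (borcherds_fin1r l k n w f2 ff).
Qed.

Lemma borcherds_linr c a f f1 f2 l k n w : field a -> field f1 -> field f2 ->
  (forall j x, f j x = c *: f1 j x + f2 j x) ->
  borcherds a f l k n w = c *: borcherds a f1 l k n w + borcherds a f2 l k n w.
Proof.
move=> fa ff1 ff2 e; rewrite /borcherds -lincombB; congr (_ - _ *: _).
  apply: fs_lincomb => [||i]; last by rewrite e (field_lin _ fa).
  - exact: (borcherds_fin1l l k n w fa ff1).
  - exact: (borcherds_fin1l l k n w fa ff2).
apply: fs_lincomb => [||i]; last by rewrite e.
- exact: (borcherds_fin1r l k n w fa ff1).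
- exact: (borcherds_fin1r l k n w fa ff2).
Qed.

Lemma borcherds_lin a f l k n : field a -> field f -> linmap (borcherds a f l k n).
Proof.
move=> fa ff c x y; rewrite /borcherds -lincombB; congr (_ - _ *: _).
  apply: fs_lincomb => [||i]; last by rewrite (field_lin _ ff) (field_lin _ fa).
  - exact: (borcherds_fin1l l k n x fa ff).
  - exact: (borcherds_fin1l l k n y fa ff).
apply: fs_lincomb => [||i]; last by rewrite (field_lin _ fa) (field_lin _ ff).
- exact: (borcherds_fin1r l k n x fa ff).
- exact: (borcherds_fin1r l k n y fa ff).
Qed.

Lemma borcherds_nat_eq0 a f : field a -> field f ->
  (forall k n w, a k (f n w) = f n (a k w)) ->
  forall (l : nat) k n w, borcherds a f l%:Z k n w = 0.
Proof.
move=> fa ff e; elim=> [|l IH] k n w; first by rewrite borcherds0 e subrr.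
have -> : Posz l.+1 = l%:Z + 1 by lia.
by rewrite borcherds_pascal // !IH subrr.
Qed.

Lemma gbin1 m : C m 1 = m%:~R.
Proof. by rewrite /gbin big_ord1 divr1 subr0. Qed.

(** * The affine Lie algebra acting on fields *)

Section LieAction.
Variables (a b ab : int -> V -> V) (beta : F) (cc : V -> V).
Hypotheses (fa : field a) (fb : field b) (fab : field ab).
Hypothesis ab_comm : forall k n w, a k (b n w) - b n (a k w) =
  ab (k + n) w + ((k%:~R * beta) * (k + n == 0)%:R) *: cc w.

(** Each level is a difference of the previous one. The bracket term depends only on [k + n] and
    disappears at level 1; the central term is linear in [k], leaves a constant at level 1 and
    disappears at level 2. *)
Lemma borcherds_generators (l : nat) n w :
  borcherds a b l%:Z 0 n w =
    if l == 0%N then ab n w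
    else if l == 1%N then (beta * (n == -1)%:R) *: cc w else 0.
Proof.
have b0 k n' : borcherds a b 0 k n' w =
    ab (k + n') w + ((k%:~R * beta) * (k + n' == 0)%:R) *: cc w.
  by rewrite borcherds0 ab_comm.
have b1 k n' : borcherds a b 1 k n' w = (beta * (k + n' == -1)%:R) *: cc w.
  have := borcherds_pascal 0 k n' w fa fb; rewrite add0r => ->; rewrite !b0.
  have -> : k + 1 + n' = k + (n' + 1) by lia.
  rewrite opprD addrACA subrr add0r -scalerBl; congr (_ *: _).
  have -> : (k + n' == -1) = (k + (n' + 1) == 0) by apply/eqP/eqP; lia.
  by rewrite intrD; ring.
have b2 (j : nat) k n' : borcherds a b j.+2%:Z k n' w = 0.
  elim: j k n' => [|j IH] k n'.
    have -> : Posz 2 = 1 + 1 by [].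
    rewrite borcherds_pascal // !b1.
    have -> : k + 1 + n' = k + (n' + 1) by lia.
    by rewrite subrr.
  have -> : Posz j.+3 = j.+2%:Z + 1 by lia.
  by rewrite borcherds_pascal // !IH subrr.
case: l => [|[|l]] //=.
- by rewrite b0 mulr0z !mul0r scale0r addr0 add0r.
by rewrite b1 add0r.
Qed.

Variable f : int -> V -> V.
Hypotheses (ff : field f) (ccl : linmap cc).

(** The operator orders are x y f, x f y, y f x, f y x. Exchanging [(x, m)] with [(y, n)] swaps the
    middle two, so they cancel in a commutator. *)
Lemma borcherds2_expand (x y : int -> V -> V) m n N w : field x -> field y ->
  borcherds x (borcherds y f n 0) m 0 N w =
  fs (fun i => S m i *: fs (fun j => S n j *: x (m - i%:Z) (y (n - j%:Z) (f (N + (i + j)%N%:Z) w))))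
  - sg n *: fs (fun i => S m i *: fs (fun j => S n j *:
      x (m - i%:Z) (f (N + n + i%:Z - j%:Z) (y j%:Z w))))
  - sg m *: fs (fun i => S m i *: fs (fun j => S n j *:
      y (n - j%:Z) (f (N + m + j%:Z - i%:Z) (x i%:Z w))))
  + (sg m * sg n) *: fs (fun i => S m i *: fs (fun j => S n j *:
      f (N + m + n - (i + j)%N%:Z) (y j%:Z (x i%:Z w)))).
Proof.
move=> fx fy.
have e (c : F) (G : nat -> nat -> V) : c *: fs (fun i => S m i *: fs (fun j => S n j *: G i j))
    = fs (fun i => (S m i * c) *: fs (fun j => S n j *: G i j)).
  by rewrite -fsZ; apply: eq_fs => i; rewrite scalerA mulrC.
have e2 (c : F) (x1 x2 x3 : V) : x1 - c *: x2 + c *: x3 = x1 - c *: (x2 - x3).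
  by rewrite scalerBr opprB addrA addrAC.
rewrite -scalerA e2.
rewrite [sg n *: _]e -fs_split2; last 2 first.
- apply: fin2I => [|i].
    have [M h] := field_trunc N w ff.
    by exists M => i j hi; rewrite h ?field0 //; lia.
  apply: (linmap_fin1 (g := fun j => x (m - i%:Z))); first by move=> _; case: fx.
  have [M h] := borcherds_fin1l n 0 (N + i%:Z) w fy ff.
  by exists M => j /h <-; congr (y _ (f _ _)); lia.
- apply: fin2C; apply: fin2I => [|j].
    have [M h] := field_trunc 0 w fy.
    by exists M => j i /h; rewrite add0r => ->; rewrite !field0.
  apply: (linmap_fin1 (g := fun i => x (m - i%:Z))); first by case: fx.
  have [M h] := field_trunc (N + n - j%:Z) (y j%:Z w) ff.
  by exists M => i /h <-; congr (f _ _); lia.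
rewrite [sg n *: _]e -fs_split2; last 2 first.
- apply: fin2I => [|i].
    have [M h] := field_trunc 0 w fx.
    by exists M => i j /h; rewrite add0r => ->; rewrite !field0.
  have [M h] := borcherds_fin1l n 0 (N + m - i%:Z) (x i%:Z w) fy ff.
  by exists M => j /h <-; congr (y _ (f _ _)); lia.
- apply: fin2I => [|i].
    have [M h] := field_trunc 0 w fx.
    by exists M => i j /h; rewrite add0r => ->; rewrite !field0.
  have [M h] := field_trunc 0 (x i%:Z w) fy.
  by exists M => j /h; rewrite add0r => ->; rewrite field0.
rewrite {1}/borcherds; congr (_ - _ *: _); apply: eq_fs => i; congr (_ *: _).
  rewrite borcherds_map //; last exact: field_lin.
  congr (_ - _ *: _); apply: eq_fs => j; congr (_ *: x _ _); try lia.
    by congr (y _ (f _ _)); lia.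
  by rewrite add0r; congr (f _ _); lia.
rewrite /borcherds add0r; congr (_ - _ *: _); apply: eq_fs => j; congr (_ *: _).
  by congr (y _ (f _ _)); lia.
by rewrite add0r; congr (f _ _); lia.
Qed.

Lemma borcherds_lie_comm m n N w :
  borcherds a (borcherds b f n 0) m 0 N w - borcherds b (borcherds a f m 0) n 0 N w =
  borcherds ab f (m + n) 0 N w + ((m%:~R * beta) * (m + n == 0)%:R) *: cc (f N w).
Proof.
have fin1_l (x y : int -> V -> V) : field x -> field y ->
    fin2 (fun i j : nat => x (m - i%:Z) (y (n - j%:Z) (f (N + (i + j)%N%:Z) w))).
  move=> fx fy; have [M h] := field_trunc N w ff.
  by exists M => i j hi; rewrite h ?field0 //; lia.
have fin1_r (x y : int -> V -> V) : field x -> field y ->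
    fin2 (fun i j : nat => f (N + m + n - (i + j)%N%:Z) (x i%:Z (y j%:Z w))).
  move=> fx fy; apply: fin2C; apply: fin2I => [|j].
    have [M h] := field_trunc 0 w fy.
    by exists M => j i /h; rewrite add0r => ->; rewrite !field0.
  have [M h] := field_trunc 0 (y j%:Z w) fx.
  by exists M => i /h; rewrite add0r => ->; rewrite field0.
rewrite !borcherds2_expand //.
set X1 := fs (fun i => S m i *: _); set X2 := fs (fun i => S m i *: _).
set X3 := fs (fun i => S m i *: _); set X4 := fs (fun i => S m i *: _).
have eX2 : fs (fun i => S n i *: fs (fun j => S m j *:
    a (m - j%:Z) (f (N + n + j%:Z - i%:Z) (b i%:Z w)))) = X2.
  rewrite fs_scale_swap //; apply: fin2I => [|i].
    have [M h] := field_trunc 0 w fb.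
    by exists M => i j /h; rewrite add0r => ->; rewrite !field0.
  have [M h] := field_trunc (N + n - i%:Z) (b i%:Z w) ff.
  by exists M => j /h; rewrite addrAC => ->; rewrite field0.
have eX3 : fs (fun i => S n i *: fs (fun j => S m j *:
    b (n - i%:Z) (f (N + m + i%:Z - j%:Z) (a j%:Z w)))) = X3.
  rewrite fs_scale_swap //; apply: fin2C; apply: fin2I => [|j].
    have [M h] := field_trunc 0 w fa.
    by exists M => i j /h; rewrite add0r => ->; rewrite !field0.
  have [M h] := field_trunc (N + m - j%:Z) (a j%:Z w) ff.
  by exists M => i /h; rewrite addrAC => ->; rewrite field0.
rewrite eX2 eX3 [sg n * _]mulrC.
set Y1 := fs (fun i => S n i *: _); set Y4 := fs (fun i => S n i *: _).
have e (x1 p q x4 y1 y4 : V) :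
    x1 - p - q + x4 - (y1 - q - p + y4) = x1 - y1 + (x4 - y4).
  rewrite opprD addrACA [y1 - q - p]addrAC; congr (_ + _).
  by rewrite -(addrA x1) -(addrA y1) opprD addrACA subrr addr0.
rewrite e -scalerBr -gsgnD.
have -> : X4 - Y4 = - fs (fun i => S (m + n) i *: f (N + (m + n) - i%:Z) (ab i%:Z w)).
  rewrite /X4 /Y4 [X in _ - X]fs_scale_swap; last first.
    have [M h] := fin1_r _ _ fa fb; exists M => i j; rewrite addnC => /h.
    by rewrite addnC [N + n + m]addrAC.
  rewrite -fs_sbinV; last first.
    have [M h] := field_trunc 0 w fab.
    by exists M => i /h; rewrite add0r => ->; rewrite field0.
  rewrite -opprB -fsB; last 2 first.
  - apply/fin1Z/fin2_fs/fin2Z; have [M h] := fin1_r _ _ fa fb.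
    by exists M => i j /h; rewrite addnC [N + n + m]addrAC.
  - by apply/fin1Z/fin2_fs/fin2Z/fin2C; have [M h] := fin1_r _ _ fb fa;
      exists M => i j /h; rewrite addnC.
  congr (- _); apply: eq_fs => i; rewrite -scalerBr; congr (_ *: _).
  rewrite -fsB; last 2 first.
  - apply: fin1Z; have [M h] := fin1_r _ _ fa fb; exists M => j hj.
    by rewrite addnC [N + n + m]addrAC h //; lia.
  - apply: fin1Z; have [M h] := fin1_r _ _ fb fa; exists M => j hj.
    by rewrite addnC h //; lia.
  apply: eq_fs => j; rewrite -scalerBr; congr (_ *: _).
  have -> : N + n + m - (j + i)%N%:Z = N + (m + n) - (i + j)%N%:Z by lia.
  have -> : N + m + n - (i + j)%N%:Z = N + (m + n) - (i + j)%N%:Z by lia.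
  rewrite -(linmapB (field_lin _ ff)) ab_comm -PoszD; congr (f _ _).
  (* To the right of [f] only modes [i, j >= 0] occur, so [i + j == 0] forces the factor [i] of the
     central term to be 0. *)
  case: i => [|i]; first by rewrite mulr0z !mul0r scale0r addr0.
  by rewrite mulr0 scale0r addr0.
have -> : X1 - Y1 =
    fs (fun i => S (m + n) i *: ab (m + n - i%:Z) (f (N + i%:Z) w)) +
    ((m%:~R * beta) * (m + n == 0)%:R) *: cc (f N w).
  pose H x := (beta * (m + n == Posz x)%:R) *: cc (f (N + x%:Z) w).
  have fH : fin1 H.
    have [M h] := field_trunc N w ff.
    by exists M => i /h; rewrite /H => ->; rewrite linmap0 ?scaler0.
  have -> : ((m%:~R * beta) * (m + n == 0)%:R) *: cc (f N w) =
      fs (fun i => S m i *: fs (fun j => S n j *: ((m - i%:Z)%:~R *: H (i + j)%N))).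
    (* Absorption (m - i) C(m, i) = m C(m - 1, i) and Vandermonde reduce the central terms to this
       sum. [H] lives at [q = m + n], where the coefficient is C(q - 1, q) up to sign: 0 unless
       [q = 0]. *)
    transitivity (m%:~R *: fs (fun q => S (m - 1 + n) q *: H q)).
      have [h|h] := eqVneq (m + n) 0.
        rewrite fs_only0 => [|i]; last by rewrite /H h mulr0 scale0r scaler0.
        have -> : S (m - 1 + n) 0 = 1 by rewrite /sbin gbin0 mulr1 expr0.
        by rewrite scale1r /H addr0 h eqxx scalerA mulrA.
      rewrite mulr0 scale0r fs_eq0 ?scaler0 // => q; rewrite /H.
      case: eqP => [hq|_]; last by rewrite mulr0 scale0r scaler0.
      have -> : m - 1 + n = q.-1%:Z by lia.
      by rewrite /sbin gbin_small ?mulr0 ?scale0r //; lia.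
    rewrite -fs_sbinV // -fsZ; apply: eq_fs => i; rewrite -!fsZ; apply: eq_fs => j.
    rewrite !scalerA; congr (_ *: _).
    have e1 : C m i * (m - i%:Z)%:~R = m%:~R * C (m - 1) i.
      by rewrite -!gbin1 gbin_trinomialC.
    move: e1; rewrite /sbin; move: (_%:~R) (m%:~R) => x y e1; ring: e1.
  rewrite -fs_sbinV; last first.
    have [M h] := field_trunc N w ff.
    by exists M => i /h ->; rewrite field0.
  rewrite -fsD; last 2 first.
  - apply/fin1Z/fin2_fs/fin2Z; have [M h] := field_trunc N w ff.
    by exists M => i j /h ->; rewrite field0.
  - apply/fin1Z/fin2_fs/fin2Z/fin2Z; case: fH => M h.
    by exists M => i j /h.
  rewrite /X1 /Y1 [X in _ - X]fs_scale_swap; last first.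
    have [M h] := field_trunc N w ff.
    by exists M => i j /h ->; rewrite !field0.
  rewrite -fsB; last 2 first.
  - by apply/fin1Z/fin2_fs/fin2Z; exact: (fin1_l a b fa fb).
  - apply/fin1Z/fin2_fs/fin2Z/fin2C; have [M h] := field_trunc N w ff.
    by exists M => i j /h ->; rewrite !field0.
  apply: eq_fs => i; rewrite -scalerBr -scalerDr; congr (_ *: _).
  rewrite -fsB; last 2 first.
  - by apply: fin1Z; exact: (fin2_fin1 i (fin1_l _ _ fa fb)).
  - apply: fin1Z; have [M h] := field_trunc N w ff.
    by exists M => j hj; rewrite h ?field0 //; lia.
  rewrite -fsD; last 2 first.
  - apply: fin1Z; have [M h] := field_trunc N w ff.
    by exists M => j hj; rewrite h ?field0 //; lia.
  - apply/fin1Z/fin1Z; case: fH => M h.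
    by exists M => j hj; rewrite h //; lia.
  apply: eq_fs => j; rewrite -scalerBr -scalerDr addnC ab_comm; congr (_ *: (_ + _)).
    by rewrite addnC; congr (ab _ _); lia.
  rewrite addnC /H scalerA !mulrA; congr ((_ * _%:R) *: _).
  by congr (nat_of_bool _); apply/eqP/eqP; lia.
rewrite /borcherds scalerN addrAC; congr (_ - _ *: _ + _); apply: eq_fs => i.
by congr (_ *: ab _ _); lia.
Qed.
End LieAction.
End Borcherds.

(** * Linear subspaces cut out by a [Prop]-valued predicate *)

Section Submodule.
Variables (F : pzRingType) (U : lmodType F) (P : U -> Prop).
Hypotheses (P0 : P 0) (PD : forall c x y, P x -> P y -> P (c *: x + y)).

Definition in_submod : {pred U} := fun x => `[< P x >].

Lemma in_submod_closed : submod_closed in_submod.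
Proof.
split; first exact/asboolP.
by move=> c x y /asboolP px /asboolP py; apply/asboolP/PD.
Qed.

HB.instance Definition _ := GRing.isSubmodClosed.Build F U in_submod in_submod_closed.

Record submod := Submod { submod_val : U; _ : submod_val \in in_submod }.
HB.instance Definition _ := [isSub for submod_val].
HB.instance Definition _ := [Choice of submod by <:].
HB.instance Definition _ := [SubChoice_isSubLmodule of submod by <:].

Definition submod_lmodType : lmodType F := submod.

Definition submod_in (x : U) (px : P x) : submod_lmodType :=
  @Submod x (introT (asboolP _) px).

Lemma submod_valP (x : submod_lmodType) : P (submod_val x).
Proof. by apply/asboolP; case: x. Qed.

Lemma submod_val_inj (x y : submod_lmodType) : submod_val x = submod_val y -> x = y.
Proof. exact: val_inj. Qed.
End Submodule.

Lemma int_seq_bound (M : nat -> int) (A : nat) :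
  exists K : nat, forall i, (i < A)%N -> M i <= K%:Z.
Proof.
elim: A => [|A [K hK]]; first by exists 0.
exists (K + `|M A|)%N => i; rewrite ltnS leq_eqVlt => /orP[/eqP->|/hK]; lia.
Qed.

(** * The induced module and the module of its fields *)

Section InducedModule.
Variables (r : nat) (g : vectType CC) (br : g -> g -> g) (B : g -> g -> CC).
Variables (V : lmodType CC).
Variables (act : g -> int -> mindex r -> V -> V) (cact : mindex r -> V -> V).
Variables (ig : g -> V) (ic i1 : V).
Hypothesis indV : is_induced_VT br B act cact ig ic i1.

Implicit Types (a b : g) (u v w : V) (k l n : int) (m p q s : mindex r).

Let tauV : is_tau_module br B act cact. Proof. by case: indV. Qed.

Let TV : is_T_map br B act ig ic i1. Proof. by case: indV => _ []. Qed.

Let act_lin_g k m v c a b : act (c *: a + b) k m v = c *: act a k m v + act b k m v.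
Proof. by case: tauV => h _; apply: h. Qed.

Let act_lin a k m : linmap (act a k m).
Proof. by case: tauV => _ [h _]; exact: h. Qed.

Let cact_lin m : linmap (cact m).
Proof. by case: tauV => _ [_ [h _]]; exact: h. Qed.

Let act_comm a b k l m p v : act a k m (act b l p v) - act b l p (act a k m v) =
  act (br a b) (k + l) (m + p) v + ((k%:~R * B a b) * (k + l == 0)%:R) *: cact (m + p) v.
Proof. by case: tauV => _ [_ [_ [h _]]]. Qed.

Let cact_act a k m p v : cact m (act a k p v) = act a k p (cact m v).
Proof. by case: tauV => _ [_ [_ [_ [h _]]]]. Qed.

Let cact_cact m p v : cact m (cact p v) = cact p (cact m v).
Proof. by case: tauV => _ [_ [_ [_ [_ h]]]]. Qed.

Let act_ig a b (k : nat) m : act a k%:Z m (ig b) =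
  if k == 0%N then ig (br a b) else if k == 1%N then B a b *: ic else 0.
Proof. by case: TV => _ []. Qed.

Let act_ic a (k : nat) m : act a k%:Z m ic = 0.
Proof. by case: TV => _ [_ []]. Qed.

Let act_i1 a (k : nat) m : act a k%:Z m i1 = 0.
Proof. by case: TV => _ [_ []]. Qed.

(** [P] cuts out a submodule containing the image of T. The universal map into it, followed by the
    inclusion, is the identity by the uniqueness clause. *)
Lemma induced_ind (P : V -> Prop) : P 0 ->
  (forall c x y, P x -> P y -> P (c *: x + y)) ->
  (forall a k m x, P x -> P (act a k m x)) -> (forall m x, P x -> P (cact m x)) ->
  (forall a, P (ig a)) -> P ic -> P i1 -> forall v, P v.
Proof.
move=> P0 PD Pact Pcact Pig Pic Pi1.
pose W : lmodType CC := @submod_lmodType CC V P P0 PD.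
pose val (x : W) : V := submod_val x.
have valP (x : W) : P (val x) by exact: (@submod_valP CC V P P0 PD).
have vinj (x y : W) : val x = val y -> x = y by exact: (@submod_val_inj CC V P P0 PD).
pose ins x (px : P x) : W := @submod_in CC V P P0 PD x px.
pose actW a k m (x : W) : W := ins _ (Pact a k m _ (valP x)).
pose cactW m (x : W) : W := ins _ (Pcact m _ (valP x)).
have valL c (x y : W) : val (c *: x + y) = c *: val x + val y by [].
have tauW : is_tau_module br B actW cactW.
  split; first by move=> k m v c a b; apply: vinj; rewrite valL; exact: act_lin_g.
  split; first by move=> a k m c x y; apply: vinj; rewrite valL; exact: act_lin.
  split; first by move=> m c x y; apply: vinj; rewrite valL; exact: cact_lin.
  split; first by move=> a b k l m n v; apply: vinj; exact: act_comm.
  split; first by move=> a k m n v; apply: vinj; exact: cact_act.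
  by move=> m n v; apply: vinj; exact: cact_cact.
have TW : is_T_map br B actW (fun a => ins _ (Pig a)) (ins _ Pic) (ins _ Pi1).
  split; first by move=> c a b; apply: vinj; rewrite valL; case: TV => h _; exact: h.
  split.
    move=> a b k m; apply: vinj; rewrite [LHS]act_ig.
    by case: eqP => // _; case: eqP.
  by split=> a k m; apply: vinj; [exact: act_ic|exact: act_i1].
case: indV => _ [_ univ] v.
have [[phi [[phiL [phia phic]] [phig [phi_c phi1]]]] _] := univ W _ _ _ _ _ tauW TW.
have [_ uniq] := univ V _ _ _ _ _ tauV TV.
have -> : v = val (phi v); last exact: valP.
apply: (uniq (fun x => x) (fun x => val (phi x))) => //.
- split; first by move=> c x y; rewrite phiL valL.
  by split=> *; rewrite ?phia ?phic.
- by move=> a; rewrite phig.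
- by rewrite phi_c.
by rewrite phi1.
Qed.

(** The generator stays quantified in the induction, since moving [a] past [b] produces [br a b]. *)
Lemma act_trunc w a : exists N : int, forall k m, N <= k -> act a k m w = 0.
Proof.
move: w a; apply: induced_ind.
- by move=> a; exists 0 => k m _; rewrite linmap0.
- move=> c x y hx hy a; have [N hN] := hx a; have [M hM] := hy a.
  exists (`|N| + `|M|) => k m hk; rewrite act_lin hN ?hM ?scaler0 ?addr0 //; lia.
- move=> b l p w hw a; have [N hN] := hw a; have [M hM] := hw (br a b).
  (* The part [|l| + 1] keeps [k + l] above [M] and away from 0, where the central term sits. *)
  exists (`|N| + `|M| + `|l| + 1) => k m hk.
  have /eqP := act_comm a b k l m p w; rewrite subr_eq => /eqP ->.
  rewrite hN; last by lia.
  rewrite linmap0 // hM; last by lia.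
  have -> : (k + l == 0) = false by apply/eqP; lia.
  by rewrite mulr0 scale0r !addr0.
- move=> p w hw a; have [N hN] := hw a; exists N => k m hk.
  by rewrite -cact_act hN // linmap0.
- move=> b a; exists 2 => k m hk.
  have -> : k = (`|k|%N - 2).+2%:Z by lia.
  exact: act_ig.
- move=> a; exists 0 => k m hk; have -> : k = `|k|%N%:Z by lia.
  exact: act_ic.
move=> a; exists 0 => k m hk; have -> : k = `|k|%N%:Z by lia.
exact: act_i1.
Qed.

Lemma field_act a p : field (fun k => act a k p).
Proof.
split=> [k|w]; first exact: act_lin.
by have [N h] := act_trunc w a; exists N => k /h.
Qed.

(** The truncation in x_0 is uniform in the torus index, as membership in
    V[[x_1^{+-1},...,x_r^{+-1}]]((x0)) requires. *)
Definition torus_field (f : int -> mindex r -> V -> V) : Prop :=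
  (forall k m, linmap (f k m)) /\
  (forall w, exists N : int, forall k m, N <= k -> f k m w = 0) /\
  (forall p k m w, cact p (f k m w) = f k m (cact p w)).

Lemma torus_field0 : torus_field 0.
Proof.
split; first by move=> k m c x y; rewrite scaler0 addr0.
split; first by move=> w; exists 0.
by move=> p k m w; rewrite linmap0.
Qed.

Lemma torus_fieldD (c : CC) f h :
  torus_field f -> torus_field h -> torus_field (c *: f + h).
Proof.
move=> [f1 [f2 f3]] [h1 [h2 h3]].
have e k m w : (c *: f + h) k m w = c *: f k m w + h k m w by [].
split; first by move=> k m d x y; rewrite !e f1 h1 !scalerDr !scalerA mulrC addrACA.
split.
  move=> w; have [N hN] := f2 w; have [M hM] := h2 w.
  exists (`|N| + `|M|) => k m hk; rewrite e hN ?hM ?scaler0 ?addr0 //; lia.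
by move=> p k m w; rewrite !e cact_lin f3 h3.
Qed.

Lemma torus_field_field f p : torus_field f -> field (fun k => f k p).
Proof.
move=> [f1 [f2 _]]; split=> [k|w]; first exact: f1.
by have [N h] := f2 w; exists N => k /h.
Qed.

(** Substituting z y for the torus variable of [a] makes [s] the total exponent of y, of which
    [s - p] remains for [f]. *)
Definition field_act_on a k p (f : int -> mindex r -> V -> V) n s w : V :=
  borcherds (fun j => act a j p) (fun j => f j (s - p)) k 0 n w.

Lemma torus_field_act a k p f : torus_field f -> torus_field (field_act_on a k p f).
Proof.
move=> Wf; have ff q := torus_field_field q Wf; have fa := field_act a p.
case: Wf => f1 [f2 f3].
split; first by move=> n s; apply: borcherds_lin.
split=> [w|q n s w]; last first.
  rewrite /field_act_on borcherds_map // /borcherds.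
  by congr (_ - _ *: _); apply: eq_fs => i; rewrite ?f3 cact_act ?f3.
(* In the terms where [a] acts first, only the finitely many vectors [act a i p w] with [i < A] are
   nonzero, so the bounds of [f] at them have a common majorant [K]. *)
have [A hA] := field_trunc 0 w fa.
have [N hN] := f2 w.
have [M hM] := choice (fun i : nat => f2 (act a i%:Z p w)).
have [K hK] := int_seq_bound M A.
exists (`|N| + K%:Z + `|k| + A%:Z) => n s hn.
rewrite /field_act_on /borcherds !fs_eq0 ?scaler0 ?subr0 // => i.
  have [iA|iA] := ltnP i A; last by rewrite add0r hA // (linmap0 (f1 _ _)) scaler0.
  by rewrite add0r hM ?scaler0 //; have := hK i iA; lia.
by rewrite hN ?(linmap0 (act_lin _ _ _)) ?scaler0 //; lia.
Qed.

Let W : lmodType CC := @submod_lmodType CC (int -> mindex r -> V -> V) torus_field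
  torus_field0 torus_fieldD.
Let ev (x : W) : int -> mindex r -> V -> V := submod_val x.
Let mkW f (hf : torus_field f) : W :=
  @submod_in CC _ torus_field torus_field0 torus_fieldD f hf.

Lemma ev_torus_field (x : W) : torus_field (ev x).
Proof. exact: (@submod_valP CC _ torus_field torus_field0 torus_fieldD). Qed.

Lemma ev_inj (x y : W) : (forall k m w, ev x k m w = ev y k m w) -> x = y.
Proof.
move=> h; apply: (@submod_val_inj CC _ torus_field torus_field0 torus_fieldD).
by apply/funext => k; apply/funext => m; apply/funext => w; apply: h.
Qed.

Lemma ev_lin (c : CC) (x y : W) k m w : ev (c *: x + y) k m w = c *: ev x k m w + ev y k m w.
Proof. by []. Qed.

Lemma ev_field (x : W) p : field (fun k => ev x k p).
Proof. exact/torus_field_field/ev_torus_field. Qed.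

Let actW a k p (x : W) : W := mkW (torus_field_act a k p (ev_torus_field x)).

(** The action of c (x) t^p is dictated by associativity for Y(c; x_0, x) = c(x), whose only mode is
    -1. *)
Lemma torus_field_cact p (x : W) : torus_field (fun n s w => cact p (ev x n (s - p) w)).
Proof.
have [x1 [x2 x3]] := ev_torus_field x; split.
  by move=> n s c v w; rewrite x1 cact_lin.
split; last by move=> q n s w; rewrite -x3 cact_cact.
move=> w; have [N hN] := x2 w; exists N => k m hk.
by rewrite hN // (linmap0 (cact_lin _)).
Qed.

Let cactW p (x : W) : W := mkW (torus_field_cact p x).

Lemma torus_field_gen a : torus_field (act a).
Proof.
split; first exact: act_lin.
split; first by move=> w; exact: act_trunc.
by move=> p k m w; exact: cact_act.
Qed.

Lemma torus_field_central :
  torus_field (fun k m w => if k == -1 then cact m w else 0).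
Proof.
split; first by move=> k m c x y; case: eqP; rewrite ?cact_lin // scaler0 addr0.
split; last by move=> p k m w; case: eqP; rewrite 1?cact_cact // (linmap0 (cact_lin _)).
by move=> w; exists 0 => k m hk; case: eqP => // e; move: hk; rewrite e.
Qed.

Lemma torus_field_vacuum :
  torus_field (fun k m w => if (k == -1) && (m == 0) then w else 0).
Proof.
split; first by move=> k m c x y; case: ifP; rewrite // scaler0 addr0.
split; last by move=> p k m w; case: ifP; rewrite // (linmap0 (cact_lin _)).
by move=> w; exists 0 => k m hk; case: eqP => // e; move: hk; rewrite e.
Qed.

Lemma ev_act a k p (x : W) n s w : ev (actW a k p x) n s w =
  borcherds (fun j => act a j p) (fun j => ev x j (s - p)) k 0 n w.
Proof. by []. Qed.

Lemma ev_cactW p (x : W) n s w : ev (cactW p x) n s w = cact p (ev x n (s - p) w).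
Proof. by []. Qed.

Lemma ev_mkW f (hf : torus_field f) : ev (mkW hf) = f.
Proof. by []. Qed.

Lemma evD (x y : W) k m w : ev (x + y) k m w = ev x k m w + ev y k m w.
Proof. by []. Qed.

Lemma evB (x y : W) k m w : ev (x - y) k m w = ev x k m w - ev y k m w.
Proof. by []. Qed.

Lemma evZ (c : CC) (x : W) k m w : ev (c *: x) k m w = c *: ev x k m w.
Proof. by []. Qed.

Lemma tau_moduleW : is_tau_module br B actW cactW.
Proof.
split=> [k p x c a b|].
  apply: ev_inj => n s w; rewrite ev_lin.
  apply: borcherds_linl; try exact: field_act; first exact: (ev_field x).
  by move=> j v; exact: act_lin_g.
split=> [a k p c x y|].
  apply: ev_inj => n s w; rewrite ev_lin.
  by apply: borcherds_linr => //; [exact: field_act|exact: (ev_field x)|exact: (ev_field y)].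
split=> [p c x y|].
  by apply: ev_inj => n s w; rewrite ev_lin /= ; exact: cact_lin.
split.
  move=> a b m n p q x; apply: ev_inj => N s w; rewrite evB evD evZ !ev_act ev_cactW.
  (* Both orders of the two actions leave the same torus label [s - (p + q)] on [x], so
     [borcherds_lie_comm] applies at fixed labels. *)
  have e1 : borcherds (act a ^~ p) (fun j => ev (actW b n q x) j (s - p)) m 0 N w =
      borcherds (act a ^~ p)
        (borcherds (act b ^~ q) (fun j => ev x j (s - (p + q))) n 0) m 0 N w.
    apply: eq_borcherds => // j v; rewrite ev_act.
    by apply: eq_borcherds => // i z; rewrite opprD addrA.
  have e2 : borcherds (act b ^~ q) (fun j => ev (actW a m p x) j (s - q)) n 0 N w =
      borcherds (act b ^~ q)
        (borcherds (act a ^~ p) (fun j => ev x j (s - (p + q))) m 0) n 0 N w.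
    apply: eq_borcherds => // j v; rewrite ev_act.
    by apply: eq_borcherds => // i z; rewrite [p + q]addrC opprD addrA.
  rewrite e1 e2.
  apply: (@borcherds_lie_comm CC V _ _ _ (B a b) (cact (p + q))).
  - exact: field_act.
  - exact: field_act.
  - exact: field_act.
  - by move=> k l v; exact: act_comm.
  - exact: ev_field.
  exact: cact_lin.
split.
  move=> a k m p x; apply: ev_inj => n s w; rewrite ev_cactW !ev_act.
  rewrite borcherds_map; [|exact: cact_lin|exact: field_act|exact: ev_field].
  rewrite /borcherds; congr (_ - _ *: _); apply: eq_fs => i; congr (_ *: _).
    by rewrite cact_act ev_cactW [s - m - p]addrAC.
  by rewrite ev_cactW [s - m - p]addrAC.
move=> m n x; apply: ev_inj => k s w.
by rewrite !ev_cactW cact_cact [s - m - n]addrAC.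
Qed.

(** The relations of T on g are the products computed in [borcherds_generators]; c(x) and the
    identity field commute with all generators, so products of level [k >= 0] with them vanish. *)
Lemma T_mapW : is_T_map br B actW (fun a => mkW (torus_field_gen a))
  (mkW torus_field_central) (mkW torus_field_vacuum).
Proof.
split; first by move=> c a b; apply: ev_inj => n s w; rewrite ev_lin; exact: act_lin_g.
split.
  move=> a b k p; apply: ev_inj => n s w.
  have h := @borcherds_generators CC V (act a ^~ p) (act b ^~ (s - p))
    (act (br a b) ^~ (p + (s - p))) (B a b) (cact (p + (s - p))).
  rewrite [LHS]h; first last.
  - by move=> *; exact: act_comm.
  - exact: field_act.
  - exact: field_act.
  rewrite [p + _]addrC subrK; case: eqP => // _; case: eqP => // _.
  transitivity (B a b *: (if n == -1 then cact s w else 0)); last by [].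
  by case: eqP => _; rewrite ?mulr1 // mulr0 scale0r scaler0.
split=> a k p; apply: ev_inj => n s w.
  apply: borcherds_nat_eq0; first exact: field_act.
    exact: (torus_field_field _ torus_field_central).
  by move=> j i v /=; case: ifP => _; rewrite ?cact_act ?(linmap0 (act_lin _ _ _)).
apply: borcherds_nat_eq0; first exact: field_act.
  exact: (torus_field_field _ torus_field_vacuum).
by move=> j i v /=; case: ifP => _ //; rewrite (linmap0 (act_lin _ _ _)).
Qed.

Lemma exists_state_field : exists Y : V -> int -> mindex r -> V -> V,
  [/\ forall k m w, linmap (fun u => Y u k m w),
      forall u, torus_field (Y u),
      forall a k p u n s w, Y (act a k p u) n s w =
        borcherds (fun j => act a j p) (fun j => Y u j (s - p)) k 0 n w,
      forall p u n s w, Y (cact p u) n s w = cact p (Y u n (s - p) w) &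
      [/\ forall a, Y (ig a) = act a,
          forall k m w, Y ic k m w = if k == -1 then cact m w else 0 &
          forall k m w, Y i1 k m w = if (k == -1) && (m == 0) then w else 0]].
Proof.
case: indV => _ [_ univ].
have [[phi [[phiL [phia phic]] [phig [phi_c phi1]]]] _] :=
  univ W _ _ _ _ _ tau_moduleW T_mapW.
exists (fun u => ev (phi u)); split.
- by move=> k m w c u v; rewrite phiL ev_lin.
- by move=> u; exact: ev_torus_field.
- by move=> a k p u n s w; rewrite phia ev_act.
- by move=> p u n s w; rewrite phic ev_cactW.
split; first by move=> a; rewrite phig ev_mkW.
  by move=> k m w; rewrite phi_c ev_mkW.
by move=> k m w; rewrite phi1 ev_mkW.
Qed.

(** * Vacuum, commutator, Jacobi identity and uniqueness for the state-field map *)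

Section StateField.
Variable Y : V -> int -> mindex r -> V -> V.
Hypothesis Y_lin : forall k m w, linmap (fun u => Y u k m w).
Hypothesis Y_torus : forall u, torus_field (Y u).
Hypothesis Y_act : forall a k p u n s w, Y (act a k p u) n s w =
  borcherds (fun j => act a j p) (fun j => Y u j (s - p)) k 0 n w.
Hypothesis Y_cact : forall p u n s w, Y (cact p u) n s w = cact p (Y u n (s - p) w).
Hypothesis Y_ig : forall a, Y (ig a) = act a.
Hypothesis Y_ic : forall k m w, Y ic k m w = if k == -1 then cact m w else 0.
Hypothesis Y_i1 : forall k m w, Y i1 k m w = if (k == -1) && (m == 0) then w else 0.

Local Notation C := (gbin CC).
Local Notation S := (sbin CC).

Lemma Y0 k m w : Y 0 k m w = 0.
Proof. exact: (linmap0 (@Y_lin k m w)). Qed.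

Lemma Y_field u p : field (fun k => Y u k p).
Proof. exact: torus_field_field. Qed.

Lemma Y_linr u k m : linmap (Y u k m).
Proof. by case: (Y_torus u). Qed.

Lemma cact_Y p u k m w : cact p (Y u k m w) = Y u k m (cact p w).
Proof. by case: (Y_torus u) => _ []. Qed.

Lemma Y_lower_trunc u p v s : lower_trunc (fun l n w => Y (Y u l p v) n s w).
Proof.
have [_ [h _]] := Y_torus u; have [N hN] := h v.
by exists N => k hk n w; rewrite hN // Y0.
Qed.

(** In the associativity formula for a_l u every term first applies to [i1] either a nonnegative
    mode of [a] or, when [k >= 0], a nonnegative mode of [u]. *)
Lemma Y_vacuum v k m : 0 <= k -> Y v k m i1 = 0.
Proof.
move: v k m; apply: induced_ind.
- by move=> k m _; rewrite Y0.
- by move=> c x y hx hy k m hk; rewrite Y_lin hx // hy // scaler0 addr0.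
- move=> a l p u hu k m hk; rewrite Y_act /borcherds !fs_eq0 ?scaler0 ?subr0 // => i.
    by rewrite add0r act_i1 (linmap0 (Y_linr _ _ _)) scaler0.
  by rewrite hu ?(linmap0 (act_lin _ _ _)) ?scaler0 //; lia.
- by move=> p u hu k m hk; rewrite Y_cact hu // (linmap0 (cact_lin _)).
- move=> a k m hk; rewrite Y_ig; have -> : k = `|k|%N%:Z by lia.
  exact: act_i1.
- by move=> k m hk; rewrite Y_ic; case: eqP => // e; move: hk; rewrite e.
by move=> k m hk; rewrite Y_i1; case: eqP => // e; move: hk; rewrite e.
Qed.

Definition jacobi u v := forall p q l k n w,
  fs (fun i => C k i *: Y (Y u (l + i%:Z) p v) (k + n - i%:Z) (p + q) w) =
  borcherds (fun j => Y u j p) (fun j => Y v j q) l k n w.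

Definition commutator a v := forall p q k n w,
  act a k p (Y v n q w) - Y v n q (act a k p w) =
  fs (fun i => C k i *: Y (act a i%:Z p v) (k + n - i%:Z) (p + q) w).

Lemma jacobi_lin c x y v : jacobi x v -> jacobi y v -> jacobi (c *: x + y) v.
Proof.
move=> hx hy p q l k n w.
rewrite (@borcherds_linl CC V c _ (fun j => Y x j p) (fun j => Y y j p)).
- rewrite -hx -hy; apply: fs_lincomb.
  + by have [N h] := Y_lower_trunc x p v (p + q); exists `|N - l|%N => i hi; apply: h; lia.
  + by have [N h] := Y_lower_trunc y p v (p + q); exists `|N - l|%N => i hi; apply: h; lia.
  by move=> i; rewrite Y_lin Y_lin.
- exact: Y_field.
- exact: Y_field.
- exact: Y_field.
by move=> j z; exact: Y_lin.
Qed.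

(** Covers both c and the vacuum. The field of [u] commutes with all others, and for negative [l]
    its single mode -1 is met only at [l = -1], [i = 0]. *)
Lemma jacobi_central u (D : mindex r -> V -> V) :
  (forall k p w, Y u k p w = if k == -1 then D p w else 0) ->
  (forall p v n q w, D p (Y v n q w) = Y v n q (D p w)) ->
  (forall p v n q w, Y (D p v) n (p + q) w = D p (Y v n q w)) ->
  forall v, jacobi u v.
Proof.
move=> Yu D_Y Y_D v p q.
have comm k n w : Y u k p (Y v n q w) = Y v n q (Y u k p w).
  by rewrite !Yu; case: eqP => // _; rewrite (linmap0 (Y_linr _ _ _)).
apply: (@borcherds_full CC V (fun j => Y u j p) (fun j => Y v j q)
   (fun l n w => Y (Y u l p v) n (p + q) w)).
- exact: Y_field.
- exact: Y_field.
- exact: Y_lower_trunc.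
- move=> k n w; rewrite comm subrr fs_eq0 // => i.
  by rewrite Yu Y0 scaler0.
case=> [l|l] n w.
  rewrite borcherds_nat_eq0 //; try exact: Y_field.
  by rewrite Yu Y0.
rewrite /borcherds [X in _ *: X]fs_eq0 => [|i]; last first.
  by rewrite add0r Yu /= (linmap0 (Y_linr _ _ _)) scaler0.
rewrite scaler0 subr0; case: l => [|l].
  rewrite fs_only0 => [|i]; last first.
    rewrite Yu; have -> : (Negz 0 + 0 - i.+1%:Z == -1) = false by apply/eqP; lia.
    by rewrite scaler0.
  by rewrite !Yu /sbin expr0 mul1r gbin0 scale1r Y_D /= addr0.
rewrite Yu Y0 fs_eq0 // => i; rewrite Yu.
have -> : (Negz l.+1 + 0 - i%:Z == -1) = false by apply/eqP; lia.
by rewrite scaler0.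
Qed.

Lemma jacobi_ic v : jacobi ic v.
Proof.
apply: (@jacobi_central ic cact) => //.
  by move=> p x n q w; exact: cact_Y.
by move=> p x n q w; rewrite Y_cact [p + q]addrC addrK.
Qed.

Lemma jacobi_i1 v : jacobi i1 v.
Proof.
apply: (@jacobi_central i1 (fun p w => if p == 0 then w else 0)).
- by move=> k p w; rewrite Y_i1; case: eqP.
- by move=> p x n q w; case: eqP => //= _; rewrite (linmap0 (Y_linr _ _ _)).
by move=> p x n q w; case: eqP => [->|_]; rewrite ?add0r // Y0.
Qed.

Lemma jacobi0 v : jacobi 0 v.
Proof.
move=> p q l k n w; rewrite fs_eq0 => [|i]; last by rewrite Y0 Y0 scaler0.
rewrite /borcherds !fs_eq0 ?scaler0 ?subr0 // => i.
  by rewrite Y0 (linmap0 (Y_linr _ _ _)) scaler0.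
by rewrite Y0 scaler0.
Qed.

Lemma jacobi_ig a v : commutator a v -> jacobi (ig a) v.
Proof.
move=> h p q; rewrite Y_ig.
apply: (@borcherds_full CC V (act a ^~ p) (fun j => Y v j q)
   (fun l n w => Y (act a l p v) n (p + q) w)).
- exact: field_act.
- exact: Y_field.
- by rewrite -Y_ig; exact: Y_lower_trunc.
- by move=> k n w; exact: h.
by move=> l n w; rewrite Y_act [p + q]addrC addrK.
Qed.

Lemma commutator_ig a b : commutator a (ig b).
Proof.
move=> p q k n w; rewrite Y_ig act_comm.
(* Only [i = 0] (the bracket) and [i = 1] (the form, with [C k 1 = k]) contribute. *)
rewrite (@fsE _ _ 2) => [|[|[|i]] //= _]; last by rewrite act_ig /= Y0 scaler0.
rewrite !big_ord_recr big_ord0 /= add0r !act_ig /= (linmapZ (Y_lin _ _ _)).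
rewrite gbin0 scale1r gbin1 scalerA Y_ig Y_ic subr0; congr (_ + _).
have -> : (k + n - 1 == -1) = (k + n == 0) by apply/eqP/eqP; lia.
by case: eqP => _; rewrite ?mulr1 ?mulr0 ?scale0r ?scaler0.
Qed.

Lemma act_eventually0 a p v : exists N, forall j, (N <= j)%N -> act a j%:Z p v = 0.
Proof.
have [N h] := field_trunc 0 v (field_act a p).
by exists N => j /h; rewrite add0r.
Qed.

Lemma jacobi_act_ig a b (j : nat) p v : commutator (br a b) v ->
  jacobi (act a j%:Z p (ig b)) v.
Proof.
move=> h; rewrite act_ig; case: eqP => _; first exact: jacobi_ig.
case: eqP => _; last exact: jacobi0.
rewrite -[_ *: ic]addr0; apply: jacobi_lin; [exact: jacobi_ic|exact: jacobi0].
Qed.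

Lemma commutatorP v a : commutator a v.
Proof.
move: v a; apply: induced_ind.
- move=> a p q k n w; rewrite !Y0 (linmap0 (act_lin _ _ _)) subrr fs_eq0 // => i.
  by rewrite (linmap0 (act_lin _ _ _)) Y0 scaler0.
- move=> c x y hx hy a p q k n w.
  rewrite !Y_lin act_lin.
  transitivity (c *: (act a k p (Y x n q w) - Y x n q (act a k p w)) +
     (act a k p (Y y n q w) - Y y n q (act a k p w))).
    by rewrite opprD addrACA scalerBr.
  rewrite hx hy; symmetry; apply: fs_lincomb => [||i].
  + by have [N h] := act_eventually0 a p x; exists N => i /h ->; exact: Y0.
  + by have [N h] := act_eventually0 a p y; exists N => i /h ->; exact: Y0.
  by rewrite act_lin Y_lin.
- move=> b l p' v hv a p q k n w.
  apply: (@comm_bv CC V (act a ^~ p) (act b ^~ p') (fun j => Y v j (q - p'))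
    (fun j => Y (act b l p' v) j q)
    (fun j n w => Y (act a j%:Z p v) n (p + (q - p')) w)
    (fun j n w => Y (act a j%:Z p (ig b)) n (p + p') w)
    (fun i n w => Y (act a i%:Z p (act b l p' v)) n (p + q) w)
    (fun i n w => Y (act b l p' (act a i%:Z p v)) n (p + q) w)
    (fun j i n w => Y (Y (act a j%:Z p (ig b)) i (p + p') v) n (p + q) w) l).
  + exact: field_act.
  + exact: field_act.
  + exact: Y_field.
  + by move=> j; exact: Y_field.
  + by move=> j; exact: Y_field.
  + by have [N h] := act_eventually0 a p v; exists N => j /h -> *; exact: Y0.
  + by have [N h] := act_eventually0 a p (ig b); exists N => j /h -> *; exact: Y0.
  + by move=> j; exact: Y_lower_trunc.
  + have [N h] := act_eventually0 a p (ig b).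
    by exists N => j /h -> *; rewrite !Y0.
  + by move=> m z; exact: Y_act.
  + move=> i m z.
    have := @commutator_ig a b p p' i%:Z l v; rewrite Y_ig => /eqP.
    rewrite subr_eq addrC => /eqP ->; rewrite (linmapD (Y_lin _ _ _)); congr (_ + _).
    rewrite (fs_linZ (f := fun x => Y x m (p + q) z)).
    * by apply: eq_fs => j; congr (_ *: Y (Y _ _ _ _) _ _ _); lia.
    * exact: Y_lin.
    by have [N h] := act_eventually0 a p (ig b); exists N => j /h ->; exact: Y0.
  + by move=> i m z; rewrite Y_act addrA.
  + by move=> m m' z; exact: hv.
  + by move=> m m' z; rewrite -commutator_ig Y_ig.
  (* The Jacobi identity of a_j b with v, obtained from the induction hypothesis at the generator
     [br a b]. *)
  move=> j l' k' n' z.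
  have := jacobi_act_ig j p (hv (br a b)) (p + p') (q - p') l' k' n' z.
  by rewrite (_ : p + p' + (q - p') = p + q) // addrACA subrr addr0.
- move=> p' v hv a p q k n w.
  rewrite !Y_cact -cact_act -(linmapB (cact_lin _)) hv fs_linZ.
  + by apply: eq_fs => i; rewrite -cact_act Y_cact addrA.
  + exact: cact_lin.
  by have [N h] := act_eventually0 a p v; exists N => j /h ->; exact: Y0.
- by move=> b a; exact: commutator_ig.
- move=> a p q k n w; rewrite fs_eq0 => [|i]; last by rewrite act_ic Y0 scaler0.
  rewrite !Y_ic; case: eqP => _; first by rewrite cact_act subrr.
  by rewrite (linmap0 (act_lin _ _ _)) subrr.
move=> a p q k n w; rewrite fs_eq0 => [|i]; last by rewrite act_i1 Y0 scaler0.
rewrite !Y_i1; case: ifP => _; first by rewrite subrr.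
by rewrite (linmap0 (act_lin _ _ _)) subrr.
Qed.

Lemma jacobiP u v : jacobi u v.
Proof.
move: u v; apply: induced_ind.
- exact: jacobi0.
- by move=> c x y hx hy v; exact: jacobi_lin.
- move=> a m p1 u hu v p q l k n w.
  have e1 : p - p1 + q = p + q - p1 by rewrite addrAC.
  have e2 : p - p1 + (p1 + q) = p + q by rewrite addrA subrK.
  (* The torus label [p] of a_m u is shared out as [p1] for the generator and [p - p1] for [u]. *)
  apply: (@borcherds_assoc CC V (act a ^~ p1) (fun j => Y u j (p - p1))
    (fun j => Y v j q) (fun j => Y (act a m p1 u) j p)
    (fun i n w => Y (Y u i (p - p1) v) n (p - p1 + q) w)
    (fun j n w => Y (act a j%:Z p1 v) n (p1 + q) w)
    (fun M i n w => Y (act a M p1 (Y u i (p - p1) v)) n (p + q) w)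
    (fun i j n w => Y (Y u i (p - p1) (act a j%:Z p1 v)) n (p + q) w)
    (fun i n w => Y (Y (act a m p1 u) i p v) n (p + q) w) m).
  + exact: field_act.
  + exact: Y_field.
  + exact: Y_field.
  + by move=> i; exact: Y_field.
  + by move=> i; exact: Y_field.
  + exact: Y_lower_trunc.
  + by have [N h] := act_eventually0 a p1 v; exists N => j /h -> *; exact: Y0.
  + by move=> j; exact: Y_lower_trunc.
  + have [N h] := act_eventually0 a p1 v; exists N => j /h -> *.
    by rewrite (linmap0 (Y_linr _ _ _)) Y0.
  + by move=> n' z; exact: Y_act.
  + move=> i n' z; rewrite Y_act.
    rewrite (borcherds_map (g := fun x => Y x n' (p + q) z)).
    * by congr (_ - _ *: _); apply: eq_fs => j; rewrite ?addr0 ?add0r.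
    * exact: Y_lin.
    * exact: field_act.
    exact: Y_field.
  + by move=> i j n' z; rewrite Y_act e1.
  + by move=> l' k' n' z; exact: hu.
  + by move=> j l' k' n' z; rewrite -hu e2.
  by move=> k' n' z; exact: commutatorP.
(* [cact p1] commutes with all modes, so it can be applied to the whole identity for [u] at label
   [p - p1]. *)
- move=> p1 u hu v p q l k n w.
  transitivity (cact p1 (borcherds (fun j => Y u j (p - p1)) (fun j => Y v j q) l k n w)).
    rewrite -hu fs_linZ.
    + by apply: eq_fs => i; rewrite Y_cact Y_cact [p - p1 + q]addrAC.
    + exact: cact_lin.
    have [N h] := Y_lower_trunc u (p - p1) v (p - p1 + q).
    by exists `|N - l|%N => i hi; apply: h; lia.
  rewrite borcherds_map; [|exact: cact_lin|exact: Y_field|exact: Y_field].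
  rewrite /borcherds; congr (_ - _ *: _); apply: eq_fs => i; congr (_ *: _).
    by rewrite Y_cact.
  by rewrite Y_cact cact_Y.
- by move=> a v; apply: jacobi_ig; exact: commutatorP.
- exact: jacobi_ic.
exact: jacobi_i1.
Qed.

Lemma toroidal_VA : is_toroidal_VA Y i1.
Proof.
split; first exact: Y_lin.
split; first exact: Y_linr.
split; first by move=> u w; case: (Y_torus u) => _ [].
split; first exact: Y_i1.
split; first by move=> v k m; exact: Y_vacuum.
move=> u v w l k n p s.
have := jacobiP u v p (s - p) l k n w; rewrite [p + _]addrC subrK /borcherds.
have [N1 h1] : fin1 (fun i : nat => Y (Y u (l + i%:Z) p v) (k + n - i%:Z) s w).
  have [N h] := Y_lower_trunc u p v s.
  by exists `|N - l|%N => i hi; apply: h; lia.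
have [N2 h2] := borcherds_fin1l l k n w (Y_field u p) (Y_field v (s - p)).
have [N3 h3] := borcherds_fin1r l k n w (Y_field u p) (Y_field v (s - p)).
rewrite (@fsE _ _ N1) => [|i /h1->]; last exact: scaler0.
rewrite (@fsE _ _ N2) => [|i /h2->]; last exact: scaler0.
rewrite (@fsE _ _ N3) => [|i /h3->]; last exact: scaler0.
(* From here on a partial sum covers the supports of all three families and equals their full
   sums. *)
move=> e; exists (N1 + N2 + N3)%N => K hK.
transitivity (\sum_(i < K) C k i *: Y (Y u (l + i%:Z) p v) (k + n - i%:Z) s w).
  by [].
transitivity (\sum_(i < N1) C k i *: Y (Y u (l + i%:Z) p v) (k + n - i%:Z) s w).
  apply: (@sum_trunc CC V (fun i : nat => C k i *: Y (Y u (l + i%:Z) p v) (k + n - i%:Z) s w)).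
    by move=> i /h1 ->; exact: scaler0.
  by lia.
rewrite e.
have <- := @sum_trunc CC V (fun i : nat => S l i *: Y u (l + k - i%:Z) p
  (Y v (n + i%:Z) (s - p) w)) N2 K; last 2 first.
- by move=> i /h2 ->; exact: scaler0.
- by lia.
have <- := @sum_trunc CC V (fun i : nat => S l i *: Y v (n + l - i%:Z) (s - p)
  (Y u (k + i%:Z) p w)) N3 K; last 2 first.
- by move=> i /h3 ->; exact: scaler0.
- by lia.
rewrite scaler_sumr -sumrB; apply: eq_bigr => i _.
rewrite [RHS]scalerBr; congr (_ - _).
by rewrite [LHS]scalerA [RHS]scalerA [l + n]addrC; congr (_ *: _); exact: mulrC.
Qed.

Lemma state_field_unique Y' : is_toroidal_VA Y' i1 ->
  (forall k m w, Y' ic k m w = if k == -1 then cact m w else 0) ->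
  (forall a k m w, Y' (ig a) k m w = act a k m w) ->
  forall u k m w, Y' u k m w = Y u k m w.
Proof.
move=> [Ylin' [Ylinr' [_ [vac' [_ jac']]]]] Yic' Yig'.
have Y'0 k m w : Y' 0 k m w = 0 by exact: (linmap0 (Ylin' k m w)).
have [_ [_ [_ [_ [_ jac]]]]] := toroidal_VA.
(* The Jacobi identity at [k = 0]: as [binz 0 i = 0] for [i > 0], its left side is the single field
   of t_l u, while its right side involves only the fields of [t] and [u]. *)
have step t u l p : (forall k m w, Y' t k m w = Y t k m w) ->
    (forall k m w, Y' u k m w = Y u k m w) ->
    forall k m w, Y' (Y t l p u) k m w = Y (Y t l p u) k m w.
  move=> et eu k m w.
  have [N1 h1] := jac' t u w l 0 k p m.
  have [N2 h2] := jac t u w l 0 k p m.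
  have first_term (G : nat -> V) : \sum_(i < (N1 + N2).+1) binz 0 i *: G i = G 0.
    rewrite big_ord_recl /= big1 ?addr0 => [|i _].
      by rewrite (_ : binz 0 0 = C 0 0) // gbin0 scale1r.
    by rewrite (_ : binz 0 _ = C 0 i.+1) // gbin0n scale0r.
  have e0 (x : int) : x + 0%:Z = x by exact: addr0.
  have e1 : 0 + k - 0%:Z = k by lia.
  have <- : \sum_(i < (N1 + N2).+1)
      binz 0 i *: Y (Y t (l + i%:Z) p u) (0 + k - i%:Z) m w = Y (Y t l p u) k m w.
    by rewrite (first_term (fun i => Y (Y t (l + i%:Z) p u) (0 + k - i%:Z) m w)) e0 e1.
  have <- : \sum_(i < (N1 + N2).+1)
      binz 0 i *: Y' (Y' t (l + i%:Z) p u) (0 + k - i%:Z) m w = Y' (Y t l p u) k m w.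
    by rewrite (first_term (fun i => Y' (Y' t (l + i%:Z) p u) (0 + k - i%:Z) m w)) e0 e1 et.
  rewrite h1 ?h2; try lia; apply: eq_bigr => i _.
  by rewrite !et !eu.
apply: induced_ind.
- by move=> k m w; rewrite Y'0 Y0.
- by move=> c x y hx hy k m w; rewrite Ylin' Y_lin hx hy.
- by move=> a l p u hu k m w; rewrite -Y_ig; apply: step => // *; rewrite Yig' Y_ig.
- move=> p u hu k m w.
  (* Written as a mode of [ic], the central action falls under [step] as well. *)
  have -> : cact p u = Y ic (-1) p u by rewrite Y_ic.
  by apply: step => // *; rewrite Yic' Y_ic.
- by move=> a k m w; rewrite Yig' Y_ig.
- by move=> k m w; rewrite Yic' Y_ic.
by move=> k m w; rewrite vac' Y_i1.
Qed.
End StateField.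
End InducedModule.

Theorem theorem4p3 :
  forall (r : nat) (g : vectType CC) (br : g -> g -> g) (B : g -> g -> CC),
  (0 < r)%N ->
  is_simple_lie br ->
  normalized_killing br B ->
  forall (V : lmodType CC)
         (act : g -> int -> mindex r -> V -> V) (cact : mindex r -> V -> V)
         (ig : g -> V) (ic i1 : V),
  is_induced_VT br B act cact ig ic i1 ->
  let P := fun Y : V -> int -> mindex r -> V -> V =>
    is_toroidal_VA Y i1 /\
    (forall k m w, Y ic k m w = if k == -1 then cact m w else 0) /\
    (forall a k m w, Y (ig a) k m w = act a k m w) in
  exists Y, P Y /\
    forall Y', P Y' -> forall u k m w, Y' u k m w = Y u k m w.
Proof.
move=> r g br B _ _ _ V act cact ig ic i1 indV P.
have [Y [Ylin Ytorus Yact Ycact [Yig Yic Yi1]]] := exists_state_field indV.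
exists Y; split.
  split; first exact: (toroidal_VA indV Ylin Ytorus Yact Ycact Yig Yic Yi1).
  by split=> // a k m w; rewrite Yig.
move=> Y' [Y'VA [Y'ic Y'ig]].
exact: (state_field_unique indV Ylin Ytorus Yact Ycact Yig Yic Yi1).
Qed.
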